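(* Let $\varphi(z)\in\mathbb{Q}(z)$ be a rational function of degree $d\ge 2$ such that $\varphi(0)=0$, but $\varphi$ does not vanish to order $d$ at $z=0$. Let $\alpha\in\mathbb{Q}$ be a point with infinite orbit under iteration of $\varphi$. For each $n\ge 0$ write $\varphi^n(\alpha)=A_n/B_n\in\mathbb{Q}$ as a fraction in lowest terms. Then the Zsigmondy set $\mathcal{Z}\bigl((A_n)_{n\ge0}\bigr)$ is finite.
   Context: $\varphi^n$ denotes the $n$-th iterate of $\varphi$ (with $\varphi^0$ the identity). The orbit of $\alpha$ is $\{\alpha,\varphi(\alpha),\varphi^2(\alpha),\dots\}$. For a sequence of integers $(A_n)$, a prime $p$ is a primitive divisor of $A_n$ if $p\mid A_n$ and $p\nmid A_i$ for all indices $i<n$ of the sequence; the Zsigmondy set $\mathcal{Z}((A_n))$ is the set of indices $n$ such that $A_n$ has no primitive divisor. *)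

(* Defs.v *)
From mathcomp Require Import all_boot all_order all_algebra.
Set Implicit Arguments. Unset Strict Implicit. Unset Printing Implicit Defensive.
Import Order.TTheory GRing.Theory Num.Theory.
Local Open Scope ring_scope.

(* A rational function phi = f/g in Q(z), with f, g coprime polynomials,
   acting on P^1(Q) = option rat  (None stands for the point at infinity). *)

Definition rdeg (f g : {poly rat}) : nat := (maxn (size f) (size g)).-1.

Definition ratfun_eval (f g : {poly rat}) (x : option rat) : option rat :=
  match x with
  | Some q => if g.[q] == 0 then None else Some (f.[q] / g.[q])
  | None =>
      if (size g < size f)%N then None
      else if (size f < size g)%N then Some 0
      else Some (lead_coef f / lead_coef g)
  end.

Definition ratfun_iter (f g : {poly rat}) (n : nat) (x : option rat) : option rat :=
  iter n (ratfun_eval f g) x.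

(* numerator A of a point of P^1(Q) written A/B in lowest terms
   (infinity = 1/0) *)
Definition pnum (x : option rat) : int :=
  match x with Some q => numq q | None => 1 end.

Definition primitive_divisor (A : nat -> int) (n p : nat) : Prop :=
  prime p /\ (p%:Z %| A n)%Z /\ (forall i, (i < n)%N -> ~ (p%:Z %| A i)%Z).

Definition in_zsigmondy (A : nat -> int) (n : nat) : Prop :=
  ~ (exists p, primitive_divisor A n p).

Definition nat_set_finite (S : nat -> Prop) : Prop :=
  exists N, forall n, S n -> (n < N)%N.

(* Main.v *)
(* Write phi = F/G with F = X^e P in integral homogeneous form, where P(0) <> 0 and e < d.
   If A_n has no primitive divisor, then every prime dividing P(A_(n-1), B_(n-1))
   divides a fixed integer M: away from M, a prime dividing some A_i divides all later A_j, and
   P(A, B) is congruent to P(0) B^(d-e) modulo A.  Pulling back by phi^k, the form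
   P o phi^k takes at (A_(n-1-k), B_(n-1-k)) a value composed of primes dividing M only.  The zero
   sets of these forms for distinct k are disjoint, so all but finitely many avoid infinity and
   the critical points of phi, and some P o phi^k has at least three distinct zeros.  The
   Thue-Mahler theorem then leaves finitely many possible points of the orbit.

   The Thue-Mahler theorem is proved by Thue's method with an auxiliary polynomial
   U(X) + Y V(X), at two solutions x, y with height y much larger than height x, estimated
   at the real place and at the primes dividing M simultaneously.  Expanding around y, instead of around
   the algebraic number approximated by x and y, keeps all the estimates inside Q. *)

Require Import Defs.
From mathcomp Require Import all_boot all_order all_algebra all_field.
From mathcomp Require Import zify ring lra.
From Stdlib Require Import Classical.
Set Implicit Arguments. Unset Strict Implicit. Unset Printing Implicit Defensive.
Import Order.TTheory GRing.Theory Num.Theory.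
Local Open Scope ring_scope.

(** * Siegel's lemma and the auxiliary pair *)

(** Thue's exponent is enough because the form has D >= 3 distinct zeros. For H(y) about H(x)^(24
    q), the auxiliary value with denominators cleared is a nonzero integer of size at most C^q
    H(x)^(13 q D) H(y), while the approximations at the chosen places together gain about H(x)^(D
    (24 q - j)) for some j <= q. So 23 D has to exceed 13 D + 24, which D = 3 allows (69 against
    63). The numbers 13 and 24 also satisfy 2 * 13 > 24, needed by Siegel's lemma, and 24 (D - 1) >
    13 D, needed by the Wronskian. The obstacle is that a solution may spread its approximation over
    the places in any proportion, and may approach different zeros at different places. A set of
    solutions of unbounded height is therefore thinned out, place by place, until the proportions
    agree up to a rounding of 1/K and the elements are close to each other wherever they approximate
    at all. The choice of x and y is thus part of an argument by contradiction, and no explicit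
    bound on heights results. *)

Lemma siegel_lemma (I J : finType) (M : I -> J -> int) (A T : nat) :
  (forall i j, `|M i j| <= A%:Z) ->
  ((2 * (#|I| * A * T)).+1 ^ #|J| < T.+1 ^ #|I|)%N ->
  exists x : I -> int, [/\ exists i, x i != 0, forall i, `|x i| <= T%:Z
    & forall j, \sum_i x i * M i j = 0].
Proof.
move=> MA; set B := (#|I| * A * T)%N => hc.
pose v (x : {ffun I -> 'I_T.+1}) j : int := \sum_i (x i)%:Z * M i j.
have vB x j : `|v x j| <= B%:Z.
  apply: le_trans (ler_norm_sum _ _ _) _.
  apply: (@le_trans _ _ (\sum_(i : I) (A * T)%N%:Z)).
    apply: ler_sum => i _; rewrite normrM mulnC PoszM.
    rewrite ler_pM //; have := ltn_ord (x i); lia.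
  by rewrite sumr_const -mulr_natr natz -PoszM /B mulnC mulnA.
(* Each value lies in [-B, B]; the shift by [B] makes it one of 2 B + 1 naturals, so that pigeonhole
   applies to [f]. *)
pose f (x : {ffun I -> 'I_T.+1}) : {ffun J -> 'I_(2 * B).+1} :=
  [ffun j => inord (absz (v x j + B%:Z))].
have [|nf] := boolP (injectiveb f).
  by move/injectiveP/leq_card; rewrite !card_ffun !card_ord leqNgt hc.
have [x [y [nxy fxy]]] : exists x y, x != y /\ f x = f y.
  by case/injectivePn: nf => x [y nxy fxy]; exists x, y.
exists (fun i => (x i)%:Z - (y i)%:Z); split.
- apply/existsP; apply: contraR nxy => /existsPn h; apply/eqP/ffunP => i.
  by apply: val_inj; move: (h i); rewrite negbK subr_eq0 => /eqP [].
- by move=> i; have := ltn_ord (x i); have := ltn_ord (y i); lia.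
- move=> j; have := congr1 (fun g : {ffun J -> 'I_(2 * B).+1} => val (g j)) fxy.
  rewrite /f /= !ffunE !inordK; try by (have := vB x j; have := vB y j; lia).
  move=> h; have {h} : v x j = v y j by have := vB x j; have := vB y j; lia.
  rewrite /v => /eqP; rewrite -subr_eq0 -sumrB => /eqP h.
  by rewrite -[RHS]h; apply: eq_bigr => i _; rewrite mulrBl.
Qed.

Lemma polyint_bounded (p : {poly int}) : exists c : nat, forall k, `|p`_k| <= c%:Z.
Proof.
exists (\sum_(i < size p) absz (p`_i)%R)%N => k.
have [h|h] := ltnP k (size p); last by rewrite nth_default.
by rewrite (bigD1 (Ordinal h)) //=; lia.
Qed.

(* The remainder of 'X^k modulo the monic polynomial s. *)
Fixpoint rpow (s : {poly int}) (k : nat) : {poly int} :=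
  if k is k'.+1 then 'X * rpow s k' - (rpow s k')`_(size s).-2 *: s else 1.

Lemma size_rpow (s : {poly int}) k :
  s \is monic -> (1 < size s)%N -> (size (rpow s k) <= (size s).-1)%N.
Proof.
move=> smon ssz; have [D sD] : exists D, size s = D.+2.
  by exists (size s).-2; move: ssz; case: size => [|[]].
rewrite sD /=; elim: k => [|k IH] /=; first by rewrite size_poly1.
apply/leq_sizeP => j hj; rewrite coefB coefXM coefZ sD /=.
have -> : (j == 0%N) = false by case: j hj.
have [->|jD] := eqVneq j D.+1.
  have -> : s`_D.+1 = 1 by rewrite -(monicP smon) lead_coefE sD.
  by rewrite mulr1 subrr.
have hj2 : (D.+2 <= j)%N by move: hj jD; clear; lia.
rewrite (nth_default _ (s := s)); last by rewrite sD.
rewrite mulr0 subr0; apply: nth_default.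
by apply: leq_trans IH _; case: j hj2 {hj jD}.
Qed.

Section Rpow.
Variables (s : {poly int}).

Lemma rpow_modE k : exists Q, 'X^k = rpow s k + Q * s.
Proof.
elim: k => [|k [Q IH]] /=; first by exists 0; rewrite mul0r addr0.
exists ('X * Q + ((rpow s k)`_(size s).-2)%:P).
by rewrite exprS IH -mul_polyC; ring.
Qed.

(** One reduction step multiplies the coefficients by at most c + 1. Growth exponential in [k] is
    affordable, since [k] will be bounded by a multiple of [q]. *)
Lemma rpow_coef (c : nat) k j :
  (forall i, `|s`_i| <= c%:Z) -> `|(rpow s k)`_j| <= (c.+1 ^ k)%N%:Z.
Proof.
move=> hc; elim: k j => [|k IH] j /=.
  by rewrite coef1 expn0; case: (j == 0%N).
rewrite coefB coefXM coefZ.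
have h1 : `|if j == 0%N then 0 else (rpow s k)`_j.-1| <= (c.+1 ^ k)%N%:Z.
  by case: ifP => // _; rewrite normr0.
have h2 : `|(rpow s k)`_(size s).-2 * s`_j| <= (c.+1 ^ k)%N%:Z * c%:Z.
  by rewrite normrM ler_pM.
rewrite expnS; apply: le_trans (ler_normB _ _) _.
apply: le_trans (lerD h1 h2) _; rewrite PoszM; nia.
Qed.

Lemma sum_rpow_dvd (I : finType) (e : I -> nat) (a : I -> int) :
  \sum_i a i *: rpow s (e i) = 0 -> exists Q, \sum_i a i *: 'X^(e i) = Q * s.
Proof.
move=> h; have /fin_all_exists [Q hQ] i : exists Q, 'X^(e i) = rpow s (e i) + Q * s by exact: rpow_modE.
exists (\sum_i a i *: Q i); rewrite mulr_suml -[RHS]add0r -[X in X + _]h -big_split /=.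
by apply: eq_bigr => i _; rewrite hQ scalerDr -scalerAl.
Qed.

End Rpow.


Lemma leq_wexp2r m n e : (m <= n)%N -> (m ^ e <= n ^ e)%N.
Proof. by case: e => // e h; rewrite leq_exp2r. Qed.

(** With T = E^12, the left side is at most (E (T + 1))^(24 q d), and E^(24 q d) = T^(2 q d) is
    exactly what the surplus of unknowns over equations absorbs. *)
Lemma siegel_ineq (E q d : nat) : (0 < E)%N ->
  ((E * E ^ 12).+1 ^ (24 * q * d) < (E ^ 12).+1 ^ (2 * (13 * q * d).+1))%N.
Proof.
move=> E0; set T := (E ^ 12)%N.
apply: (@leq_ltn_trans ((E * T.+1) ^ (24 * q * d))).
  by apply: leq_wexp2r; nia.
rewrite expnMn (_ : (24 * q * d = 12 * (2 * q * d))%N); last by lia.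
rewrite [(E ^ _)%N]expnM -/T.
have -> : (2 * (13 * q * d).+1 = (2 * q * d).+2 + 12 * (2 * q * d))%N by lia.
rewrite expnD ltn_pmul2r ?expn_gt0 //.
apply: (@leq_ltn_trans (T.+1 ^ (2 * q * d))).
  by apply: leq_wexp2r.
by rewrite ltn_exp2l //; rewrite ltnS expn_gt0 E0.
Qed.

Lemma nderivn_sum (n i : nat) (x : nat -> int) :
  (\poly_(k < n) x k)^`N(i) = \sum_(k < n) (x k *+ 'C(k, i)) *: 'X^(k - i).
Proof.
rewrite poly_def linear_sum /=; apply: eq_bigr => k _.
by rewrite linearZ /= nderivnXn -scaler_nat scalerA mulr_natr.
Qed.

Lemma leq_bin_exp2 n k : ('C(n, k) <= 2 ^ n)%N.
Proof.
elim: n k => [|n IH] [|k] //=; first by rewrite bin0 expn_gt0.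
by rewrite binS expnS mul2n -addnn leq_add.
Qed.

Lemma leq_4S_exp8 n : (2 * (2 * n.+1) <= 8 ^ n.+1)%N.
Proof. by elim: n => // n IH; rewrite expnS; lia. Qed.

(* The polynomial U(X) + Y V(X) vanishes to order 24 q in X at (b, b) for every
   root b of s.  With D = deg s these are 24 q D linear conditions on more than
   26 q D coefficients, hence the exponent 12 = 24 / (26 - 24) in Siegel's lemma. *)
Definition aux_pair (s : {poly int}) (c q : nat) (U V : {poly int}) : Prop :=
  let r := (13 * q * (size s).-1)%N in
  [/\ (size U <= r.+1)%N /\ (size V <= r.+1)%N, (U != 0) || (V != 0),
      forall k, `|U`_k| <= (c ^ q)%N%:Z /\ `|V`_k| <= (c ^ q)%N%:Z
    & forall i, (i < 24 * q)%N -> exists Q, U^`N(i) + 'X * V^`N(i) = Q * s].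

Lemma aux_pair_exists (s : {poly int}) : s \is monic -> (1 < size s)%N ->
  exists c : nat, forall q, (0 < q)%N -> exists U V : {poly int}, aux_pair s c q U V.
Proof.
move=> smon ssz; have [c hc] := polyint_bounded s; set D := (size s).-1.
have D0 : (0 < D)%N by rewrite /D; case: (size s) ssz => [|[]].
(* Below, E <= (16 (c + 1))^(r + 1) with r + 1 <= 14 D q, and Siegel's lemma returns coefficients up
   to E^12. *)
exists ((16 * c.+1) ^ (14 * D * 12))%N => q q0.
set r := (13 * q * D)%N; set A := ((2 * c.+1) ^ r.+1)%N.
pose I := (bool * 'I_r.+1)%type; pose J := ('I_(24 * q) * 'I_D)%type.
(* The unknown (b, k) is the coefficient of X^k Y^b. After the i-th derivative in X, Y is set equal
   to X, whence the exponent k - i + b. For k < i the truncated subtraction is harmless, as the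
   binomial vanishes. *)
pose M (k : I) (j : J) : int := 'C(k.2, j.1)%:R * (rpow s (k.2 - j.1 + k.1))`_j.2.
have MA k j : `|M k j| <= A%:Z.
  rewrite /M /A normrM expnMn PoszM ler_pM //.
    rewrite natz ger0_norm // lez_nat; apply: leq_trans (leq_bin_exp2 _ _) _.
    by rewrite leq_exp2l //; have := ltn_ord k.2; lia.
  apply: le_trans (rpow_coef _ _ hc) _; rewrite lez_nat leq_pexp2l //.
  by have := ltn_ord k.2; case: (k.1) => /=; lia.
pose E := (2 * (2 * r.+1) * A)%N; have E0 : (0 < E)%N by rewrite /E !muln_gt0 expn_gt0.
have cI : #|{: I}| = (2 * r.+1)%N by rewrite card_prod card_bool card_ord.
have cJ : #|{: J}| = (24 * q * D)%N by rewrite card_prod !card_ord.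
have [|x [[k0 xk0] xT xM]] := @siegel_lemma _ _ M A (E ^ 12)%N MA.
  rewrite cI cJ (_ : 2 * (2 * r.+1 * A * E ^ 12) = E * E ^ 12)%N; last by rewrite mulnA [in LHS]mulnA.
  exact: siegel_ineq.
have TE : (E ^ 12 <= ((16 * c.+1) ^ (14 * D * 12)) ^ q)%N.
  rewrite -expnM (_ : (14 * D * 12 * q = 14 * D * q * 12)%N); last by lia.
  rewrite [X in (_ <= X)%N]expnM leq_exp2r //.
  apply: (@leq_trans ((16 * c.+1) ^ r.+1)); last by rewrite leq_exp2l // /r; nia.
  rewrite (_ : (16 * c.+1 = 8 * (2 * c.+1))%N); last by lia.
  by rewrite [X in (_ <= X)%N]expnMn -/A leq_mul2r leq_4S_exp8 orbT.
pose u b (k : nat) : int := x (b, inord k).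
exists (\poly_(k < r.+1) u false k), (\poly_(k < r.+1) u true k); split.
- by rewrite !size_poly.
- case: k0 xk0 => [b k0] xk0; apply: contraNT xk0; rewrite negb_or !negbK.
  move=> /andP[/eqP h1 /eqP h2]; apply/eqP.
  have := congr1 (fun p : {poly int} => p`_k0) h1.
  have := congr1 (fun p : {poly int} => p`_k0) h2.
  by rewrite !coef_poly ltn_ord /u !inord_val !coef0; case: b.
- have aux b k : `|(\poly_(k < r.+1) u b k)`_k| <= (((16 * c.+1) ^ (14 * D * 12)) ^ q)%N%:Z.
    rewrite coef_poly; case: ifP => _; last by rewrite normr0.
    by apply: le_trans (xT _) _; rewrite lez_nat.
  by move=> k; split; apply: aux.
- move=> i hi.
  have [|Q hQ] := @sum_rpow_dvd s _ (fun k : I => (k.2 - i + k.1)%N) (fun k : I => x k *+ 'C(k.2, i)).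
    apply/polyP => t; rewrite coef0 coef_sum.
    have [ht|ht] := ltnP t D; last first.
      apply: big1 => k _; rewrite coefZ nth_default ?mulr0 //.
      exact: leq_trans (size_rpow _ smon ssz) ht.
    rewrite -[RHS](xM (Ordinal hi, Ordinal ht)); apply: eq_bigr => k _.
    by rewrite coefZ /M /= mulrA mulr_natr.
  exists Q; rewrite -hQ !nderivn_sum mulr_sumr.
  rewrite [RHS](eq_bigr (fun p : I => (x (p.1, p.2) *+ 'C(p.2, i)) *: 'X^(p.2 - i + p.1))); last by case.
  rewrite -(pair_bigA _ (fun b k => x (b, k) *+ 'C(k, i) *: 'X^(k - i + b))) /=.
  rewrite big_bool [LHS]addrC /=; congr (_ + _); apply: eq_bigr => k _.
    by rewrite /u inord_val addn1 exprS -scalerAr.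
  by rewrite /u inord_val addn0.
Qed.

(** * Non-vanishing of the auxiliary polynomial, through the Wronskian *)

Lemma separable_exp_dvd (K : numFieldType) (s G : {poly K}) m :
  separable_poly s -> (forall i, (i < m)%N -> s %| G^`(i)) -> s ^+ m %| G.
Proof.
move=> ss; elim: m G => [|m IH] G hG; first by rewrite expr0 dvd1p.
have /dvdpP [Q GQ] : s ^+ m %| G by apply: IH => i im; apply: hG; lia.
have hG' : s ^+ m %| G^`().
  by apply: IH => i im; rewrite -derivSn; apply: hG.
case: m IH hG GQ hG' => [|m] _ hG GQ hG'; first exact: (hG 0%N).
have s0 : s != 0 := separable_poly_neq0 ss.
(* Differentiating G = Q s^(m+1) leaves s^(m+1) dividing (m + 1) s^m s' Q. As s is coprime to s' and
   the characteristic is 0, s divides Q; no roots are needed. *)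
have : s ^+ m * s %| s ^+ m * (m.+1%:R *: (s^`() * Q)).
  rewrite -exprSr.
  have -> : s ^+ m * (m.+1%:R *: (s^`() * Q)) = G^`() - Q^`() * s ^+ m.+1.
    rewrite GQ derivM deriv_exp /= scaler_nat addrAC subrr add0r.
    by rewrite !mulrnAr; congr (_ *+ _); ring.
  by rewrite dvdp_sub // dvdp_mull.
rewrite dvdp_mul2l ?expf_neq0 // dvdpZr ?pnatr_eq0 // Gauss_dvdpr => [sQ|].
  by rewrite GQ exprS dvdp_mul2r ?expf_neq0.
by move: ss; rewrite separable_poly.unlock.
Qed.

Lemma derivn_dvd (K : numFieldType) (s G : {poly K}) i :
  s %| G^`N(i) -> s %| G^`(i).
Proof. by rewrite nderivn_def -scaler_nat dvdpZr // pnatr_eq0 -lt0n fact_gt0. Qed.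

Lemma deriv_eq0 (K : numFieldType) (p : {poly K}) :
  p^`() = 0 -> exists c, p = c%:P.
Proof.
move=> p'0; exists p`_0; apply/size1_polyC; rewrite leqNgt; apply/negP => h.
have := congr1 (fun u : {poly K} => u`_(size p).-2) p'0.
rewrite coef0 coef_deriv; case sp : (size p) h => [|[|k]] //= _ /eqP.
rewrite mulrn_eq0 /=; apply/negP.
by rewrite -[k.+1]/(k.+2.-1) -sp -lead_coefE lead_coef_eq0 -size_poly_eq0 sp.
Qed.

(** After division by the gcd, u v' = u' v with u, v coprime makes u divide u'. By degree u' = 0,
    and u is constant in characteristic 0; likewise v. *)
Lemma wronskian_eq0 (K : numFieldType) (U V : {poly K}) :
  (U != 0) || (V != 0) -> U * V^`() - U^`() * V = 0 ->
  exists c d g, [/\ g != 0, U = c *: g, V = d *: g & (c != 0) || (d != 0)].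
Proof.
move=> UV0 W0; set g := gcdp U V.
have g0 : g != 0 by rewrite gcdp_eq0 negb_and.
have Uu : U = (U %/ g) * g by rewrite divpK // dvdp_gcdl.
have Vv : V = (V %/ g) * g by rewrite divpK // dvdp_gcdr.
have cuv : coprimep (U %/ g) (V %/ g) by apply: coprimep_div_gcd.
move: (U %/ g) (V %/ g) Uu Vv cuv => u v Uu Vv cuv.
have W1 : u * v^`() = u^`() * v.
  apply/eqP; rewrite -subr_eq0; have /eqP := W0.
  rewrite Uu Vv !derivM (_ : _ - _ = (u * v^`() - u^`() * v) * (g * g)); last by ring.
  by rewrite mulf_eq0 mulf_eq0 (negPf g0) !orbF.
have dv_deriv (p q r : {poly K}) : coprimep p q -> p * r = p^`() * q -> exists c, p = c%:P.
  move=> cpq e; apply: deriv_eq0; apply/eqP; apply: contraT => p'0.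
  have : p %| p^`() by rewrite -(Gauss_dvdpl _ cpq) -e dvdp_mulr.
  move/(dvdp_leq p'0); rewrite leqNgt lt_size_deriv //.
  by apply: contraNneq p'0 => ->; rewrite deriv0.
have [c uc] := dv_deriv _ _ _ cuv W1.
have [d vd] : exists d, v = d%:P.
  by apply: (dv_deriv v u u^`()); [rewrite coprimep_sym | rewrite mulrC -W1 mulrC].
exists c, d, g; split => //; rewrite ?Uu ?Vv ?uc ?vd ?mul_polyC //.
rewrite -negb_and; apply: contraTN cuv => /andP [/eqP c0 /eqP d0].
by rewrite uc vd c0 d0 /coprimep gcd0p size_poly0.
Qed.

(* If the Wronskian vanished, U + Y V would be (a + b Y) g with g divisible by the
   (24 q)-th power of a divisor of s of degree at least D - 1, where D = deg s;
   but 24 (D - 1) > 13 D. *)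
Lemma aux_wronskian (K : numFieldType) (s U V : {poly K}) (q : nat) :
  separable_poly s -> (3 < size s)%N -> (0 < q)%N ->
  let r := (13 * q * (size s).-1)%N in
  (size U <= r.+1)%N -> (size V <= r.+1)%N -> (U != 0) || (V != 0) ->
  (forall i, (i < 24 * q)%N -> s %| U^`N(i) + 'X * V^`N(i)) ->
  U * V^`() - U^`() * V != 0.
Proof.
move=> ss sz q0 r sU sV UV0 sUV; apply/negP => /eqP /(wronskian_eq0 UV0).
move=> [c [d [g [g0 Uc Vd cd0]]]]; pose l := c%:P + d *: 'X.
have sl : (size l <= 2)%N.
  apply: leq_trans (size_polyD _ _) _; rewrite geq_max (leq_trans (size_polyC_leq1 _)) //=.
  by apply: leq_trans (size_scale_leq _ _) _; rewrite size_polyX.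
have l0 : l != 0.
  apply: contraTneq cd0 => l0; rewrite negb_or !negbK.
  have := congr1 (fun p : {poly K} => p`_0) l0; have := congr1 (fun p : {poly K} => p`_1) l0.
  by rewrite !coefE /= mulr0 mulr1 addr0 add0r => -> ->; rewrite eqxx.
have s0 : s != 0 := separable_poly_neq0 ss.
set e := gcdp s l; have e0 : e != 0 by rewrite gcdp_eq0 negb_and s0.
have es : s = (s %/ e) * e by rewrite divpK // dvdp_gcdl.
have el : l = (l %/ e) * e by rewrite divpK // dvdp_gcdr.
have cop : coprimep (s %/ e) (l %/ e) by apply: coprimep_div_gcd; rewrite s0.
have se : (size e <= 2)%N by apply: leq_trans sl; apply: dvdp_leq => //; apply: dvdp_gcdr.
set s1 := s %/ e in es cop.
have s1dvd i : (i < 24 * q)%N -> s1 %| g^`N(i).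
  move=> /sUV; rewrite Uc Vd !nderivnZ.
  have -> : c *: g^`N(i) + 'X * (d *: g^`N(i)) = l * g^`N(i).
    by rewrite /l -!mul_polyC; ring.
  by rewrite {1}es el mulrAC dvdp_mul2r // Gauss_dvdpr.
have /(dvdp_leq g0) : s1 ^+ (24 * q) %| g.
  apply: separable_exp_dvd => [|i /s1dvd]; last exact: derivn_dvd.
  by apply: dvdp_separable ss; rewrite es dvdp_mulr.
have s10 : s1 != 0 by apply: contraNneq s0 => h; rewrite es h mul0r.
rewrite leqNgt => /negP; apply.
have sg : (size g <= r.+1)%N.
  case/orP: cd0 => h; first by move: sU; rewrite Uc size_scale.
  by move: sV; rewrite Vd size_scale.
apply: leq_ltn_trans sg _.
have -> : size (s1 ^+ (24 * q)) = ((size s1).-1 * (24 * q)).+1.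
  by rewrite -size_exp prednK // lt0n size_poly_eq0 expf_neq0.
have ms : (size s = size s1 + size e - 1)%N.
  by rewrite {1}es size_mul // subn1.
move: sz q0 se ms; rewrite /r; move: (size s) (size s1) (size e); clear => a b c.
move=> *; nia.
Qed.

Local Notation pZtoQ := (map_poly (intr : int -> rat)).

Definition height (x : rat) : nat := maxn `|numq x| `|denq x|.

Lemma coefM_bound (p q : {poly int}) (n A B : nat) :
  (size p <= n)%N -> (forall i, `|p`_i| <= A%:Z) -> (forall i, `|q`_i| <= B%:Z) ->
  forall i, `|(p * q)`_i| <= (n * A * B)%N%:Z.
Proof.
move=> sp pA qB i; have -> : p = \poly_(j < n) p`_j.
  apply/polyP => j; rewrite coef_poly; case: ltnP => // h.
  by rewrite nth_default // (leq_trans sp).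
rewrite poly_def mulr_suml coef_sum; apply: le_trans (ler_norm_sum _ _ _) _.
apply: (@le_trans _ _ (\sum_(j < n) (A * B)%N%:Z)); last first.
  by rewrite sumr_const card_ord -mulr_natr natz -PoszM mulnC mulnA.
apply: ler_sum => j _; rewrite -scalerAl coefZ coefXnM normrM PoszM ler_pM //.
by case: ifP => // _; rewrite normr0.
Qed.

(** Gauss's lemma: b X - a is primitive, hence so are its powers, and divisibility over Q descends
    to Z. *)
Lemma lin_exp_dvd (W : {poly int}) (a b : int) q :
  coprime `|a| `|b| -> (b%:~R *: 'X - (a%:~R)%:P : {poly rat}) ^+ q %| pZtoQ W ->
  exists r, W = (b *: 'X - a%:P) ^+ q * r.
Proof.
move=> cab; set L : {poly int} := b *: 'X - a%:P.
have -> : b%:~R *: 'X - (a%:~R)%:P = pZtoQ L.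
  by rewrite rmorphB /= map_polyZ map_polyX map_polyC.
rewrite -rmorphXn dvdp_rat_int => /dvdpP_int [r Wr].
have cL : `|zcontents L| = 1.
  have : (zcontents L %| zcontents L)%Z by [].
  rewrite dvdz_contents => /polyOverP h.
  have := h 0%N; have := h 1%N; rewrite /L !coefE /= !mulr0 !mulr1 subr0 add0r.
  rewrite !dvdzE abszN => hb ha.
  have : (`|zcontents L| %| gcdn `|a| `|b|)%N by rewrite dvdn_gcd ha hb.
  by rewrite (eqP cab) dvdn1 => /eqP h1; rewrite -abszE h1.
have hc : zcontents (L ^+ q) * zcontents (L ^+ q) = 1.
  have : `|zcontents (L ^+ q)| = 1.
    elim: q {Wr} => [|q IH]; first by rewrite expr0 (zcontents_monic (monic1 _)).
    by rewrite exprS zcontentsM normrM cL IH mulr1.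
  by move=> h; rewrite -expr2 -real_normK ?num_real // h expr1n.
exists (zcontents (L ^+ q) *: r).
by rewrite {1}[L ^+ q]zpolyEprim -!scalerAl -scalerAr scalerA hc scale1r.
Qed.

(** A rational zero a / b of high order forces large coefficients: in W = (b X - a)^q r, the lowest
    nonzero coefficient of r gives a coefficient of W divisible by a^q, and the leading one is
    divisible by b^q. *)
Lemma lin_exp_dvd_bound (W : {poly int}) (a b : int) (q B : nat) :
  coprime `|a| `|b| -> b != 0 -> W != 0 -> (forall i, `|W`_i| <= B%:Z) ->
  (b%:~R *: 'X - (a%:~R)%:P : {poly rat}) ^+ q %| pZtoQ W ->
  (`|a| ^ q <= B)%N /\ (`|b| ^ q <= B)%N.
Proof.
move=> cab b0 W0 WB /(lin_exp_dvd cab) [r Wr].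
have r0 : r != 0 by apply: contraNneq W0 => h; rewrite Wr h mulr0.
have ex : exists k, r`_k != 0.
  by exists (size r).-1; rewrite -lead_coefE lead_coef_eq0.
split.
- case: (ex_minnP ex) => k rk kmin.
  have Wk : W`_k = (- a) ^+ q * r`_k.
    rewrite Wr coefM big_ord_recl big1 ?addr0 => [|j _].
      rewrite subn0; congr (_ * _); rewrite -!horner_coef0 horner_exp.
      by rewrite !hornerE /= ?mulr0 ?sub0r ?add0r.
    have [->|h] := eqVneq r`_(k - lift ord0 j) 0; first by rewrite mulr0.
    by have := kmin _ h; have := ltn_ord j; rewrite lift0 /=; lia.
  have := WB k; rewrite Wk normrM normrX normrN => h.
  have h1 : 1 <= `|r`_k| by move: rk; lia.
  have : `|a| ^+ q <= B%:Z by apply: le_trans h; rewrite ler_peMr // exprn_ge0.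
  by rewrite -abszE -natz -natrX natz lez_nat.
- have Wk : lead_coef W = b ^+ q * lead_coef r.
    rewrite Wr lead_coefM lead_coef_exp.
    rewrite lead_coefDl ?lead_coefZ ?lead_coefX ?mulr1 //.
    by rewrite size_polyN size_scale // size_polyX ltnS size_polyC_leq1.
  have := WB (size W).-1; rewrite -lead_coefE Wk normrM normrX => h.
  have h1 : 1 <= `|lead_coef r| by move: r0; rewrite -lead_coef_eq0; lia.
  have : `|b| ^+ q <= B%:Z by apply: le_trans h; rewrite ler_peMr // exprn_ge0.
  by rewrite -abszE -natz -natrX natz lez_nat.
Qed.

Lemma deriv_coef_bound (p : {poly int}) (n A : nat) :
  (size p <= n)%N -> (forall i, `|p`_i| <= A%:Z) ->
  forall i, `|p^`()`_i| <= (n * A)%N%:Z.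
Proof.
move=> sp pA i; rewrite coef_deriv.
have [h|h] := ltnP i.+1 (size p); last by rewrite nth_default // mul0rn normr0.
by rewrite -mulr_natl normrM natz ger0_norm // PoszM ler_pM //; lia.
Qed.

Lemma wronskian_bound (U V : {poly int}) (n A : nat) :
  (size U <= n)%N -> (size V <= n)%N -> (forall i, `|U`_i| <= A%:Z) ->
  (forall i, `|V`_i| <= A%:Z) ->
  forall i, `|(U * V^`() - U^`() * V)`_i| <= (2 * (n * n * A * A))%N%:Z.
Proof.
move=> sU sV UA VA i; rewrite coefB; apply: le_trans (ler_normB _ _) _.
have h1 := coefM_bound sU UA (deriv_coef_bound sV VA) i.
have h2 := coefM_bound sV VA (deriv_coef_bound sU UA) i.
rewrite [U^`() * V]mulrC; apply: le_trans (lerD h1 h2) _.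
by rewrite -PoszD lez_nat; apply: eq_leq; ring.
Qed.

Lemma XsubC_exp_dvd (T : {poly rat}) x q :
  (forall j, (j < q)%N -> T^`N(j).[x] = 0) -> ('X - x%:P) ^+ q %| T.
Proof.
move=> hT; apply: separable_exp_dvd => [|i iq]; last first.
  by apply: derivn_dvd; rewrite dvdp_XsubCl rootE hT.
by have := separable_prod_XsubC [:: x]; rewrite big_seq1.
Qed.

Lemma XsubC_exp_dvd_deriv (T : {poly rat}) x q :
  (forall j, (j <= q)%N -> T^`N(j).[x] = 0) -> ('X - x%:P) ^+ q %| T^`().
Proof.
move=> hT; apply: separable_exp_dvd => [|i iq]; last first.
  by rewrite -derivSn; apply: derivn_dvd; rewrite dvdp_XsubCl rootE hT.
by have := separable_prod_XsubC [:: x]; rewrite big_seq1.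
Qed.

(** If all these derivatives vanished, T = U + y V would vanish at x to order above q. The Wronskian
    equals T V' - T' V because y is constant, so (X - x)^q divides it, and its coefficients bound
    height(x)^q by an exponential in q. The resulting threshold depends neither on q nor on y. *)
Lemma aux_nonvanish (s : {poly int}) (c : nat) :
  separable_poly (pZtoQ s) -> (3 < size s)%N ->
  exists C : nat, forall (q : nat) (U V : {poly int}) (x y : rat), (0 < q)%N ->
  aux_pair s c q U V -> (C < height x)%N ->
  exists2 j, (j <= q)%N & (pZtoQ U)^`N(j).[x] + y * (pZtoQ V)^`N(j).[x] != 0.
Proof.
move=> ss sz; set D := (size s).-1.
(* The power of 2 absorbs 2 (r + 1)^2 <= 2^(2 r + 3) with r = 13 q D; each c comes from the
   coefficients of one of U and V. *)
exists (2 ^ (30 * D) * c * c)%N => q U V x y q0 [[sU sV] UV0 UVc hUV] hx.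
set r := (13 * q * (size s).-1)%N in sU sV.
have [/existsP [j hj]|] := boolP [exists j : 'I_q.+1,
    (pZtoQ U)^`N(j).[x] + y * (pZtoQ V)^`N(j).[x] != 0].
  by exists j => //; rewrite -ltnS.
rewrite negb_exists => /forallP h0; exfalso.
pose T := pZtoQ U + y *: pZtoQ V.
have T0 j : (j <= q)%N -> T^`N(j).[x] = 0.
  move=> jq; have := h0 (Ordinal (jq : (j < q.+1)%N)); rewrite negbK => /eqP /= h.
  by rewrite /T nderivnD hornerD nderivnZ hornerZ.
pose W := U * V^`() - U^`() * V.
have sQ p : size (pZtoQ p) = size p.
  exact: size_rat_int_poly.
have W0 : W != 0.
  have : pZtoQ U * (pZtoQ V)^`() - (pZtoQ U)^`() * pZtoQ V != 0.
    apply: (@aux_wronskian _ (pZtoQ s) _ _ q) => //; rewrite ?sQ //.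
      by rewrite -!size_poly_eq0 !sQ !size_poly_eq0.
    move=> i /hUV [Q hQ]; rewrite !nderivn_map -(map_polyX intr) -rmorphM -rmorphD /= hQ.
    by rewrite rmorphM dvdp_mull.
  rewrite !deriv_map -!rmorphM -rmorphB -/W.
  by apply: contraNneq => ->; rewrite rmorph0.
have dW : ('X - x%:P) ^+ q %| pZtoQ W.
  have -> : pZtoQ W = T * (pZtoQ V)^`() - T^`() * pZtoQ V.
    by rewrite /W rmorphB !rmorphM /= -!deriv_map /T derivD derivZ -!mul_polyC; ring.
  rewrite dvdp_sub // dvdp_mulr //; last exact: XsubC_exp_dvd_deriv.
  by apply: XsubC_exp_dvd => j jq; apply: T0; apply: ltnW.
have den0 : (denq x)%:~R != 0 :> rat by rewrite intr_eq0 denq_neq0.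
have dW' : ((denq x)%:~R *: 'X - ((numq x)%:~R)%:P) ^+ q %| pZtoQ W.
  have -> : (denq x)%:~R *: 'X - ((numq x)%:~R)%:P = (denq x)%:~R *: ('X - x%:P).
    by rewrite scalerBr -[_ *: x%:P]mul_polyC -polyCM numqE [x * _]mulrC.
  by rewrite exprZn dvdpZl // expf_neq0.
have Wb := wronskian_bound sU sV (fun i => (UVc i).1) (fun i => (UVc i).2).
have [h1 h2] := lin_exp_dvd_bound (coprime_num_den x) (denq_neq0 x) W0 Wb dW'.
have : (height x ^ q <= 2 * (r.+1 * r.+1 * c ^ q * c ^ q))%N.
  by rewrite /height; case: (leqP `|numq x| `|denq x|).
rewrite leqNgt => /negP; apply.
apply: (@leq_ltn_trans ((2 ^ (30 * D) * c * c) ^ q)); last by rewrite ltn_exp2r.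
rewrite !expnMn -expnM !mulnA !leq_mul //.
have hr : (r.+1 <= 2 ^ r.+1)%N by apply/ltnW/ltn_expl.
apply: (@leq_trans (2 ^ (1 + r.+1 + r.+1))); first by rewrite !expnD expn1 !leq_mul.
have D0 : (0 < D)%N by rewrite /D; move: sz; clear; case: (size s) => [|[]].
by rewrite leq_exp2l // /r; nia.
Qed.

(** * Absolute values on Q *)

(** Losses of this size are harmless: in the end they face height(x)^q with height(x) beyond any
    fixed constant. Requiring q > 0 lets constants be absorbed into the base. *)
Definition expb (f : nat -> nat) := exists C : nat, forall q, (0 < q)%N -> (f q <= C ^ q)%N.

Lemma expb_const k : expb (fun=> k).
Proof.
exists k => -[//|q] _; case: k => // k.
by rewrite expnS leq_pmulr // expn_gt0.
Qed.

Lemma expbD f g : expb f -> expb g -> expb (fun q => f q + g q)%N.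
Proof.
move=> [C hC] [D hD]; exists (C + D)%N => q q0.
apply: leq_trans (leq_add (hC q q0) (hD q q0)) _.
case: q q0 => // q _; elim: q => [|q IH]; rewrite ?expn1 //.
by rewrite expnS (expnS D) (expnS (C + D)); nia.
Qed.

Lemma expbM f g : expb f -> expb g -> expb (fun q => f q * g q)%N.
Proof.
move=> [C hC] [D hD]; exists (C * D)%N => q q0.
by rewrite expnMn leq_mul ?hC ?hD.
Qed.

Lemma expbX k f a : (forall q, (0 < q)%N -> (f q <= a * q)%N) -> expb (fun q => k ^ f q)%N.
Proof.
move=> fa; exists (k.+1 ^ a)%N => q q0; rewrite -expnM.
by apply: leq_trans (leq_wexp2r _ (leqnSn k)) _; rewrite leq_pexp2l ?fa.
Qed.

Lemma expb_linear f a : (forall q, (0 < q)%N -> (f q <= a * q)%N) -> expb f.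
Proof.
move=> fa; have [C hC] := expbX 2 fa.
by exists C => q q0; apply: leq_trans (hC q q0); apply/ltnW/ltn_expl.
Qed.

(** The plain triangle inequality suffices, so that real and p-adic places are treated alike; values
    in [rat] suffice as well, p-adic values being powers of p. *)
Record is_absval (v : rat -> rat) : Prop := IsAbsval {
  av_ge0 : forall x, 0 <= v x;
  av_eq0 : forall x, (v x == 0) = (x == 0);
  avM : forall x y, v (x * y) = v x * v y;
  avD : forall x y, v (x + y) <= v x + v y }.

Section Absval.
Variables (v : rat -> rat) (hv : is_absval v).

Lemma av0 : v 0 = 0. Proof. by apply/eqP; rewrite (av_eq0 hv). Qed.

Lemma av1 : v 1 = 1.
Proof.
have h : v 1 != 0 by rewrite (av_eq0 hv) oner_eq0.
by apply: (mulfI h); rewrite mulr1 -(avM hv) mulr1.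
Qed.

Lemma avN x : v (- x) = v x.
Proof.
have h : v (-1) = 1.
  have : v (-1) ^+ 2 = 1 by rewrite expr2 -(avM hv) mulrNN mulr1 av1.
  by move/eqP; rewrite sqrp_eq1 ?(av_ge0 hv) // => /eqP.
by rewrite -mulN1r (avM hv) h mul1r.
Qed.

Lemma avB x y : v (x - y) <= v x + v y.
Proof. by rewrite -(avN y) (avD hv). Qed.

Lemma avX x n : v (x ^+ n) = v x ^+ n.
Proof. by elim: n => [|n IH]; rewrite ?expr0 ?av1 // !exprS (avM hv) IH. Qed.

Lemma av_nat n : v n%:R <= n%:R.
Proof.
elim: n => [|n IH]; first by rewrite av0.
by rewrite -addn1 !natrD; apply: le_trans (avD hv _ _) _; rewrite av1 lerD.
Qed.

Lemma av_int (z : int) : v z%:~R <= `|z|%:~R.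
Proof.
case: (intP z) => [|n|n]; first by rewrite av0.
- by rewrite ger0_norm //; apply: av_nat.
- by rewrite normrN rmorphN avN ger0_norm //; apply: av_nat.
Qed.

Lemma av_sum (I : Type) (r : seq I) (P : pred I) (F : I -> rat) :
  v (\sum_(i <- r | P i) F i) <= \sum_(i <- r | P i) v (F i).
Proof.
elim/big_rec2: _ => [|i y x _ h]; first by rewrite av0.
by apply: le_trans (avD hv _ _) _; rewrite lerD2l.
Qed.

Lemma av_horner (p : {poly int}) (n B X : nat) x :
  (size p <= n)%N -> (forall i, `|p`_i| <= B%:Z) -> (0 < X)%N -> v x <= X%:R ->
  v (pZtoQ p).[x] <= (n * (B * X ^ n))%N%:R.
Proof.
move=> sp pB X0 vx; rewrite (@horner_coef_wide _ n) ?size_rat_int_poly //.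
apply: le_trans (av_sum _ _ _) _.
apply: (@le_trans _ _ (\sum_(i < n) (B * X ^ n)%N%:R)); last first.
  by rewrite sumr_const card_ord -[X in X <= _]mulr_natl -natrM.
apply: ler_sum => i _; rewrite (avM hv) coef_map /= natrM ler_pM ?(av_ge0 hv) //.
  by apply: le_trans (av_int _) _; rewrite -[B%:R]/(B%:Z%:~R) ler_int.
rewrite avX natrX; apply: (@le_trans _ _ (X%:R ^+ i)).
  by rewrite lerXn2r ?nnegrE ?(av_ge0 hv).
by rewrite -!natrX ler_nat leq_pexp2l // ltnW.
Qed.

End Absval.

Lemma absval_norm : is_absval (fun x => `|x|).
Proof.
by split=> *; rewrite ?normr_eq0 ?normrM ?ler_normD.
Qed.

Definition padic (p : nat) (x : rat) : rat :=
  if x == 0 then 0 else p%:R ^+ logn p `|denq x| / p%:R ^+ logn p `|numq x|.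

Lemma padic_frac p (a b : int) : prime p -> a != 0 -> b != 0 ->
  padic p (a%:~R / b%:~R) = p%:R ^+ logn p `|b| / p%:R ^+ logn p `|a|.
Proof.
move=> pp a0 b0; set x := a%:~R / b%:~R : rat.
have aQ : a%:~R != 0 :> rat by rewrite intr_eq0.
have bQ : b%:~R != 0 :> rat by rewrite intr_eq0.
have x0 : x != 0 by rewrite mulf_neq0 ?invr_eq0.
have p0 n : p%:R ^+ n != 0 :> rat by rewrite expf_neq0 // pnatr_eq0 -lt0n prime_gt0.
rewrite /padic (negPf x0); apply/eqP; rewrite eqr_div // -!exprD.
have e : a * denq x = numq x * b.
  apply/eqP; rewrite -(eqr_int rat) !rmorphM /= numqE /x; apply/eqP.
  by rewrite mulrAC mulfVK.
have := congr1 (fun z => logn p `|z|) e; rewrite !abszM !lognM ?absz_gt0 ?denq_neq0 ?numq_eq0 //.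
by rewrite addnC => ->; rewrite addnC.
Qed.

Lemma padic_int p (z : int) : prime p -> z != 0 -> padic p z%:~R = (p%:R ^+ logn p `|z|)^-1.
Proof.
move=> pp z0; have := padic_frac pp z0 (oner_neq0 int).
by rewrite divr1 => ->; rewrite logn1 expr0 mul1r.
Qed.

Lemma padic_le p x (a b : int) k : prime p -> x != 0 -> b != 0 -> x = a%:~R / b%:~R ->
  (p ^ k %| `|a|)%N -> padic p x <= p%:R ^+ logn p `|b| / p%:R ^+ k.
Proof.
move=> pp x0 b0 ex; have a0 : a != 0 by apply: contraNneq x0 => h; rewrite ex h mul0r.
have p0 n : 0 < p%:R ^+ n :> rat by rewrite exprn_gt0 // ltr0n prime_gt0.
rewrite ex padic_frac // pfactor_dvdn ?absz_gt0 // => h.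
rewrite ler_pM2l // lef_pV2 ?posrE // -!natrX ler_nat leq_pexp2l //.
exact: prime_gt0.
Qed.

Lemma absval_padic p : prime p -> is_absval (padic p).
Proof.
move=> pp.
have pn n : 0 < p%:R ^+ n :> rat by rewrite exprn_gt0 // ltr0n prime_gt0.
have ge0 x : 0 <= padic p x.
  by rewrite /padic; case: ifP => // _; rewrite divr_ge0 // ltW.
have eq0 x : (padic p x == 0) = (x == 0).
  rewrite /padic; case: ifP => [|_]; first by rewrite eqxx.
  by apply/negbTE; rewrite mulf_neq0 ?invr_eq0 // gt_eqF.
have nzZ x : x != 0 -> (numq x != 0) * (denq x != 0) by rewrite numq_eq0 denq_neq0.
split=> // x y.
  have [->|x0] := eqVneq x 0; first by rewrite mul0r /padic eqxx mul0r.
  have [->|y0] := eqVneq y 0; first by rewrite mulr0 /padic eqxx mulr0.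
  have -> : x * y = (numq x * numq y)%:~R / (denq x * denq y)%:~R.
    by rewrite -{1}[x]divq_num_den -{1}[y]divq_num_den !rmorphM /= invfM; ring.
  rewrite padic_frac ?mulf_neq0 ?nzZ // !abszM !lognM ?absz_gt0 ?nzZ //.
  rewrite /padic (negPf x0) (negPf y0) !exprD invfM; ring.
have [->|x0] := eqVneq x 0; first by rewrite add0r lerDr.
have [->|y0] := eqVneq y 0; first by rewrite addr0 lerDl.
have [->|xy0] := eqVneq (x + y) 0; first by rewrite /padic eqxx addr_ge0 ?ge0.
set d := denq x * denq y; have d0 : d != 0 by rewrite mulf_neq0 ?denq_neq0.
set a := numq x * denq y; set b := numq y * denq x.
have dx : (denq x)%:~R != 0 :> rat by rewrite intr_eq0 denq_neq0.
have dy : (denq y)%:~R != 0 :> rat by rewrite intr_eq0 denq_neq0.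
have ex : x = a%:~R / d%:~R.
  by rewrite /a /d !rmorphM /= numqE; field; rewrite dx dy.
have ey : y = b%:~R / d%:~R.
  by rewrite /b /d !rmorphM /= numqE; field; rewrite dx dy.
have a0 : a != 0 by apply: contraNneq x0 => h; rewrite ex h mul0r.
have b0 : b != 0 by apply: contraNneq y0 => h; rewrite ey h mul0r.
have exy : x + y = (a + b)%:~R / d%:~R by rewrite {1}ex {1}ey rmorphD mulrDl.
set k := minn (logn p `|a|) (logn p `|b|).
have ka : (p ^ k %| `|a|)%N by rewrite pfactor_dvdn ?absz_gt0 // geq_minl.
have kb : (p ^ k %| `|b|)%N by rewrite pfactor_dvdn ?absz_gt0 // geq_minr.
have kab : (p ^ k %| `|(a + b)%R|)%N.
  by move: ka kb; rewrite -[(p ^ k)%N]/`|(p ^ k)%N%:Z|%N -!dvdzE; apply: rpredD.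
apply: le_trans (padic_le pp xy0 d0 exy kab) _.
rewrite ex ey !padic_frac // -!mulrDr ler_pM2l // /k.
by rewrite /minn; case: ifP => _; rewrite ?lerDl ?lerDr invr_ge0 ltW.
Qed.

(** * Estimates at a single place *)

Lemma monic_cofactor_bound (s Q : {poly int}) (c B n : nat) :
  s \is monic -> (forall i, `|s`_i| <= c%:Z) -> (size Q <= n)%N ->
  (forall i, `|(Q * s)`_i| <= B%:Z) -> forall i, `|Q`_i| <= (B * c.+1 ^ n)%N%:Z.
Proof.
move=> smon sc; elim: n Q B => [|n IH] Q B sQ QB i.
  by rewrite (size_poly_leq0P _ sQ) coef0 normr0.
have Qn : `|Q`_n| <= B%:Z.
  have [sQn|sQn] := eqVneq (size Q) n.+1; last first.
    by rewrite nth_default ?normr0 // -ltnS ltn_neqAle sQn sQ.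
  have -> : Q`_n = lead_coef (Q * s) by rewrite lead_coef_Mmonic // lead_coefE sQn.
  exact: QB.
have QE : Q = take_poly n Q + Q`_n *: 'X^n.
  apply/polyP => j; rewrite coefD coef_take_poly coefZ coefXn.
  case: ltngtP => h; rewrite ?mulr0 ?addr0 ?mulr1 ?add0r ?h //.
  by rewrite nth_default // (leq_trans sQ).
(* Stripping the top term of Q, whose coefficient is at most B because s is monic, multiplies the
   bound on the product by at most c + 1. *)
have h1 j : `|(take_poly n Q * s)`_j| <= (B * c.+1)%N%:Z.
  have -> : take_poly n Q * s = Q * s - Q`_n *: ('X^n * s).
    by rewrite {2}QE mulrDl -scalerAl addrK.
  rewrite coefB coefZ coefXnM; apply: le_trans (ler_normB _ _) _.
  rewrite mulnS PoszD lerD // normrM PoszM ler_pM //.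
  by case: ifP => // _; rewrite normr0.
have := IH _ _ (size_take_poly _ _) h1 i; rewrite expnS mulnA => h2.
rewrite QE coefD coef_take_poly coefZ coefXn; case: eqP => [->|_].
  rewrite ltnn add0r mulr1; apply: le_trans Qn _; rewrite lez_nat.
  by rewrite -mulnA leq_pmulr // muln_gt0 expn_gt0.
by rewrite mulr0 addr0; move: h2; rewrite coef_take_poly.
Qed.

Lemma mul_bin_comp i j k :
  ('C(j + (i + k), j) * 'C(i + k, i) = 'C(i + j + k, i + j) * 'C(i + j, j))%N.
Proof.
apply/eqP; rewrite -(eqn_pmul2r (fact_gt0 j)) -(eqn_pmul2r (fact_gt0 i)) -(eqn_pmul2r (fact_gt0 k)).
have h1 := @bin_fact (j + (i + k)) j (leq_addr _ _).
have h2 := @bin_fact (i + k) i (leq_addr _ _).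
have h3 := @bin_fact (i + j + k) (i + j) (leq_addr _ _).
have h4 := @bin_fact (i + j) j (leq_addl _ _).
rewrite !addKn in h1 h2 h3; rewrite addnK in h4.
have e : (i + j + k = j + (i + k))%N by lia.
apply/eqP; transitivity ((j + (i + k))`!)%N.
  by rewrite -h1 -h2; ring.
by rewrite -e -h3 -h4; ring.
Qed.

Lemma nderivn_comp (R : nzSemiRingType) (p : {poly R}) i j :
  p^`N(j)^`N(i) = p^`N(i + j) *+ 'C(i + j, j).
Proof.
apply/polyP => k; rewrite coefMn !coef_nderivn -!mulrnA mul_bin_comp.
by rewrite addnA (addnC j).
Qed.

Lemma nderivn_coef_bound (p : {poly int}) (n A k : nat) :
  (size p <= n)%N -> (forall i, `|p`_i| <= A%:Z) ->
  forall i, `|p^`N(k)`_i| <= (2 ^ n * A)%N%:Z.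
Proof.
move=> sp pA i; rewrite coef_nderivn.
have [h|h] := ltnP (k + i) (size p); last by rewrite nth_default // mul0rn normr0.
rewrite -mulr_natl normrM natz ger0_norm // PoszM ler_pM //.
by rewrite lez_nat; apply: leq_trans (leq_bin_exp2 _ _) _; rewrite leq_exp2l //; lia.
Qed.

(* In the Taylor expansion around y, the coefficients of the powers (x - y)^i with
   i < 24 q - j are multiples of s(y). *)
Lemma local_estimate (s : {poly int}) (c X : nat) :
  s \is monic -> (0 < X)%N ->
  exists C : nat, forall (q : nat) (U V : {poly int}), (0 < q)%N ->
  aux_pair s c q U V -> forall v x y j, is_absval v -> v x <= X%:R -> v y <= X%:R -> (j <= q)%N ->
  v ((pZtoQ U)^`N(j).[x] + y * (pZtoQ V)^`N(j).[x]) <=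
    (C ^ q)%:R * (v (pZtoQ s).[y] + v (x - y) ^+ (24 * q - j)).
Proof.
move=> smon X0; have [cs hcs] := polyint_bounded s; set D := (size s).-1.
(* One more than the size allowed for U and V, because Y = X multiplies V by 'X in [T] below. *)
pose n q := (13 * q * D).+2.
pose A q := (2 * (2 ^ n q * c ^ q))%N.
pose B q := (A q * cs.+1 ^ n q)%N.
pose E q := (n q * (2 ^ (n q + q) * (n q * (B q * X ^ n q) * (2 * X) ^ n q)))%N.
have [C hC] : expb E.
  have nb q : (0 < q)%N -> (n q <= (13 * D + 2) * q)%N by rewrite /n; nia.
  have nb2 q : (0 < q)%N -> (n q + q <= (13 * D + 3) * q)%N by rewrite /n; nia.
  have idb q : (0 < q)%N -> (q <= 1 * q)%N by lia.
  have hA := expbM (expb_const 2) (expbM (expbX 2 nb) (expbX c idb)).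
  have hB := expbM hA (expbX cs.+1 nb).
  have hT := expbM (expb_linear nb) (expbM hB (expbX X nb)).
  exact: (expbM (expb_linear nb) (expbM (expbX 2 nb2) (expbM hT (expbX (2 * X) nb)))).
exists C => q U V q0 [[sU sV] _ UVc hUV] v x y j hv vx vy jq.
set r := (13 * q * (size s).-1)%N in sU sV.
set m := (24 * q)%N.
apply: (@le_trans _ _ ((E q)%:R * (v (pZtoQ s).[y] + v (x - y) ^+ (m - j)))); last first.
  apply: ler_wpM2r; first by rewrite addr_ge0 ?exprn_ge0 ?(av_ge0 hv).
  by rewrite ler_nat hC.
pose T k := U^`N(k) + 'X * V^`N(k).
have sT k : (size (T k) <= n q)%N.
  apply/leq_sizeP => i hi; rewrite coefD coefXM !coef_nderivn.
  have hi1 : (r.+1 <= i.-1)%N by case: i hi.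
  have hi2 : (r.+1 <= i)%N := leq_trans hi1 (leq_pred i).
  rewrite (nth_default _ (s := U)) ?mul0rn ?add0r; last first.
    exact: leq_trans sU (leq_trans hi2 (leq_addl _ _)).
  case: ifP => // _; rewrite nth_default ?mul0rn //.
  exact: leq_trans sV (leq_trans hi1 (leq_addl _ _)).
have TA k i : `|(T k)`_i| <= (A q)%:Z.
  have hn : (r.+1 <= n q)%N by [].
  have h1 := nderivn_coef_bound k (leq_trans sU hn) (fun i => (UVc i).1) i.
  have h2 := nderivn_coef_bound k (leq_trans sV hn) (fun i => (UVc i).2) i.-1.
  rewrite /T coefD coefXM; apply: le_trans (ler_normD _ _) _.
  rewrite /A mul2n -addnn PoszD lerD //.
  by case: ifP => // _; rewrite normr0.
have AB : (A q <= B q)%N by rewrite /B leq_pmulr // expn_gt0.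
have vs0 := av_ge0 hv (pZtoQ s).[y].
have Tv k : v (pZtoQ (T k)).[y] <= (n q * (B q * X ^ n q))%:R * (if (k < m)%N then v (pZtoQ s).[y] else 1).
  case: ifP => [km|_].
    have [Q hQ] := hUV _ km; rewrite /T hQ rmorphM hornerM (avM hv).
    apply: ler_wpM2r => //.
    have [Q0|Q0] := eqVneq Q 0; first by rewrite Q0 rmorph0 horner0 (av0 hv) ler0n.
    have sQ : (size Q <= n q)%N.
      apply: leq_trans (sT k); rewrite /T hQ size_Mmonic //.
      have : (0 < size s)%N by rewrite size_poly_gt0 monic_neq0.
      by case: (size s) => // a _; rewrite addnS leq_addr.
    apply: av_horner => //; apply: (monic_cofactor_bound smon hcs sQ).
    by move=> i; rewrite -hQ; apply: TA.
  rewrite mulr1; apply: av_horner => // i; apply: le_trans (TA k i) _.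
  by rewrite lez_nat.
set W := pZtoQ U + y *: pZtoQ V.
have WE k : W^`N(k).[y] = (pZtoQ (T k)).[y].
  rewrite /W /T nderivnD nderivnZ !rmorphD rmorphM /= map_polyX -!nderivn_map.
  by rewrite !hornerE.
have -> : (pZtoQ U)^`N(j).[x] + y * (pZtoQ V)^`N(j).[x] = W^`N(j).[y + (x - y)].
  by rewrite /W nderivnD nderivnZ hornerD hornerZ (addrC y) subrK.
rewrite (@nderiv_taylor_wide _ (n q)); last 2 first.
- exact: mulrC.
- apply/leq_sizeP => i hi; rewrite coef_nderivn /W coefD coefZ !coef_map /=.
  have hi2 : (r.+1 <= j + i)%N := leq_trans (ltnW hi) (leq_addl _ _).
  by rewrite !nth_default ?rmorph0 ?mulr0 ?addr0 ?mul0rn //; apply: leq_trans hi2.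
apply: le_trans (av_sum hv _ _ _) _.
rewrite /E natrM -mulrA.
set e := (2 ^ (n q + q) * _)%N; set z := v (pZtoQ s).[y] + v (x - y) ^+ (m - j).
have -> : (n q)%:R * (e%:R * z) = \sum_(i < n q) e%:R * z.
  by rewrite sumr_const card_ord mulr_natl.
apply: ler_sum => i _; rewrite nderivn_comp hornerMn -mulr_natr !(avM hv) (avX hv) WE.
have vh : v (x - y) <= (2 * X)%:R.
  by apply: le_trans (avB hv _ _) _; rewrite mul2n -addnn natrD lerD.
have vh0 := av_ge0 hv (x - y).
have hbin : v 'C(i + j, j)%:R <= (2 ^ (n q + q))%:R.
  apply: le_trans (av_nat hv _) _; rewrite ler_nat; apply: leq_trans (leq_bin_exp2 _ _) _.
  by rewrite leq_exp2l // leq_add // ltnW.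
have hpow k : (k <= n q)%N -> v (x - y) ^+ k <= ((2 * X) ^ n q)%:R.
  move=> kn; rewrite natrX; apply: (@le_trans _ _ ((2 * X)%:R ^+ k)).
    by rewrite lerXn2r ?nnegrE.
  by rewrite -!natrX ler_nat leq_pexp2l // muln_gt0.
set t := (if (i + j < m)%N then v (pZtoQ s).[y] else 1).
have t0 : 0 <= t by rewrite /t; case: ifP.
(* For i + j < m the factor v(s(y)) is present. Otherwise i >= m - j, and m - j factors of v(x - y)
   are set aside while the others are bounded by 2 X. *)
have th : t * v (x - y) ^+ i <=
    ((2 * X) ^ n q)%:R * (v (pZtoQ s).[y] + v (x - y) ^+ (m - j)).
  rewrite /t; case: ltnP => h.
    apply: (@le_trans _ _ (v (pZtoQ s).[y] * ((2 * X) ^ n q)%:R)).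
      by rewrite ler_wpM2l // hpow // ltnW.
    by rewrite mulrC ler_wpM2l // lerDl exprn_ge0.
  have -> : nat_of_ord i = (i - (m - j) + (m - j))%N by lia.
  rewrite mul1r exprD; apply: ler_pM; rewrite ?exprn_ge0 // ?lerDr //.
  by rewrite hpow // (leq_trans (leq_subr _ _)) // ltnW.
apply: (@le_trans _ _ ((n q * (B q * X ^ n q))%:R * t * (2 ^ (n q + q))%:R * v (x - y) ^+ i)).
  by rewrite ler_wpM2r ?exprn_ge0 // ler_pM ?(av_ge0 hv) // Tv.
rewrite [X in X <= _](_ : _ = (2 ^ (n q + q))%:R * (n q * (B q * X ^ n q))%:R * (t * v (x - y) ^+ i)); last by ring.
rewrite /e; set b := (n q * (B q * X ^ n q))%N.
have -> : (2 ^ (n q + q) * (b * (2 * X) ^ n q))%:R = (2 ^ (n q + q))%:R * b%:R * ((2 * X) ^ n q)%:R :> rat.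
  by rewrite natrM [X in _ * X]natrM mulrA.
by rewrite -[X in _ <= X]mulrA ler_wpM2l // -natrM ler0n.
Qed.

Lemma denqQ_neq0 x : (denq x)%:~R != 0 :> rat.
Proof. by rewrite intr_eq0 denq_neq0. Qed.

Lemma hom_sum (p : {poly int}) (r : nat) (x : rat) : (size p <= r.+1)%N ->
  (denq x)%:~R ^+ r * (pZtoQ p).[x] =
  (\sum_(i < r.+1) p`_i * numq x ^+ i * denq x ^+ (r - i))%:~R.
Proof.
move=> sp; rewrite (@horner_coef_wide _ r.+1) ?size_rat_int_poly // mulr_sumr rmorph_sum.
apply: eq_bigr => i _; rewrite !rmorphM !rmorphXn /= coef_map /= numqE exprMn.
have ir : (i <= r)%N by rewrite -ltnS.
by rewrite -{1}(subnKC ir) exprD; ring.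
Qed.

Lemma hom_int (p : {poly int}) (r B : nat) (x : rat) :
  (size p <= r.+1)%N -> (forall i, `|p`_i| <= B%:Z) ->
  exists2 z : int, (denq x)%:~R ^+ r * (pZtoQ p).[x] = z%:~R
    & `|z| <= (r.+1 * (B * height x ^ r))%N%:Z.
Proof.
move=> sp pB; eexists; first exact: hom_sum.
apply: le_trans (ler_norm_sum _ _ _) _.
apply: (@le_trans _ _ (\sum_(i < r.+1) (B * height x ^ r)%N%:Z)); last first.
  by rewrite sumr_const card_ord -[X in X <= _]mulr_natl natz -PoszM.
apply: ler_sum => i _; have ir : (i <= r)%N by rewrite -ltnS.
rewrite -mulrA normrM PoszM ler_pM // normrM !normrX -!abszE -!natz -!natrX natz -natrM natz lez_nat.
rewrite -[X in (_ <= _ ^ X)%N](subnKC ir) expnD leq_mul // leq_wexp2r // /height ?leq_maxl ?leq_maxr //.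
Qed.

Lemma av_horner_bounded (v : rat -> rat) (X : nat) (p : {poly rat}) : is_absval v ->
  exists2 M : rat, 0 < M & forall x, v x <= X%:R -> v p.[x] <= M.
Proof.
move=> hv; have h0 : 0 <= \sum_(i < size p) v p`_i * X%:R ^+ i.
  by apply: sumr_ge0 => i _; rewrite mulr_ge0 ?(av_ge0 hv) ?exprn_ge0.
exists (1 + \sum_(i < size p) v p`_i * X%:R ^+ i); first by rewrite ltr_pwDl.
move=> x vx; rewrite horner_coef; apply: le_trans (av_sum hv _ _ _) _.
rewrite -[leLHS]add0r lerD //; apply: ler_sum => i _.
by rewrite (avM hv) (avX hv) ler_wpM2l ?(av_ge0 hv) // lerXn2r ?nnegrE ?(av_ge0 hv).
Qed.

Lemma taylor2_bounded (v : rat -> rat) (X : nat) (p : {poly rat}) : is_absval v ->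
  exists2 M : rat, 0 < M & forall x y, v x <= X%:R -> v y <= X%:R ->
  exists2 g, v g <= M & p.[x] = p.[y] + (x - y) * (p^`().[y] + (x - y) * g).
Proof.
move=> hv.
have [M hM] : exists M : 'I_(size p) -> rat, forall i, 0 < M i /\
   forall x, v x <= X%:R -> v p^`N(i.+2).[x] <= M i.
  have /fin_all_exists [M hM] (i : 'I_(size p)) : exists M : rat, 0 < M /\
     forall x, v x <= X%:R -> v p^`N(i.+2).[x] <= M.
    by have [M M0 hM] := av_horner_bounded X (p^`N(i.+2)) hv; exists M.
  by exists M.
have s0 : 0 <= \sum_(i < size p) M i * (2 * X)%:R ^+ i.
  by apply: sumr_ge0 => i _; rewrite mulr_ge0 ?exprn_ge0 ?ler0n // ltW // (hM i).1.
exists (1 + \sum_(i < size p) M i * (2 * X)%:R ^+ i); first by rewrite ltr_pwDl.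
move=> x y vx vy; exists (\sum_(i < size p) p^`N(i.+2).[y] * (x - y) ^+ i).
  apply: le_trans (av_sum hv _ _ _) _; rewrite -[leLHS]add0r lerD //.
  apply: ler_sum => i _; rewrite (avM hv) (avX hv).
  apply: ler_pM; rewrite ?exprn_ge0 ?(av_ge0 hv) //; first by apply: (hM i).2.
  rewrite lerXn2r ?nnegrE ?(av_ge0 hv) ?ler0n //.
  by apply: le_trans (avB hv _ _) _; rewrite mul2n -addnn natrD lerD.
have -> : p.[x] = p.[y + (x - y)] by rewrite (addrC y) subrK.
rewrite (@nderiv_taylor_wide _ (size p).+2); [|exact: mulrC|by rewrite !leqW].
rewrite !big_ord_recl /= expr0 mulr1 nderivn0 nderivn1 expr1; congr (_ + _).
rewrite [RHS]mulrDr [X in X + _ = _]mulrC; congr (_ + _); rewrite !mulr_sumr; apply: eq_bigr => i _.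
by rewrite /bump /= !exprS; ring.
Qed.

(* Replaces the statement that x is close to the root of s approximated by y; Bezout
   for s and s' keeps s'(y) away from 0 when s(y) is small. *)
Lemma close_bound (v : rat -> rat) (X : nat) (s : {poly rat}) : is_absval v ->
  separable_poly s ->
  exists d t C : rat, [/\ 0 < d, 0 < t, 0 < C & forall x y, v x <= X%:R -> v y <= X%:R ->
    v s.[y] <= t -> v (x - y) <= d -> v (x - y) <= C * (v s.[x] + v s.[y])].
Proof.
move=> hv; rewrite separable_poly.unlock => /Bezout_eq1_coprimepP [[a b] /= ab].
have [Ma Ma0 hMa] := av_horner_bounded X a hv.
have [Mb Mb0 hMb] := av_horner_bounded X b hv.
have [Mg Mg0 hMg] := taylor2_bounded X s hv.
(* The bound on v(s(y)) makes the first Bezout term at most 1/2, so Mb v(s'(y)) >= 1/2. The bound on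
   v(x - y) makes the second-order Taylor term cost at most 1/4 of this. *)
exists (4 * Mb * Mg)^-1, (2 * Ma)^-1, (4 * Mb); split.
- by rewrite invr_gt0 !mulr_gt0.
- by rewrite invr_gt0 !mulr_gt0.
- by rewrite mulr_gt0.
move=> x y vx vy ht hd; have [g vg sx] := hMg x y vx vy.
have h1 : 1 <= Ma * v s.[y] + Mb * v s^`().[y].
  have := congr1 (fun p : {poly rat} => v p.[y]) ab; rewrite /= hornerD !hornerM hornerC (av1 hv) => <-.
  apply: le_trans (avD hv _ _) _; rewrite !(avM hv).
  by rewrite lerD // ler_wpM2r ?(av_ge0 hv) ?hMa ?hMb.
have h2 : Ma * v s.[y] <= 1 / 2.
  apply: le_trans (ler_wpM2l (ltW Ma0) ht) _.
  by rewrite invfM mulrCA mulfV ?gt_eqF // mulr1 mul1r.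
have h3 : 1 / 2 <= Mb * v s^`().[y] by move: h1 h2; lra.
set h := x - y in sx hd *.
have vh0 : 0 <= v h := av_ge0 hv h.
have h4 : Mb * v (h * g) <= 1 / 4.
  rewrite (avM hv); apply: (@le_trans _ _ (Mb * ((4 * Mb * Mg)^-1 * Mg))).
    by rewrite ler_wpM2l ?(ltW Mb0) // ler_pM ?(av_ge0 hv).
  by rewrite le_eqVlt; apply/orP; left; apply/eqP; field; rewrite !gt_eqF.
have h5 : v s^`().[y] <= v (s^`().[y] + h * g) + v (h * g).
  have -> : v s^`().[y] = v (s^`().[y] + h * g - h * g) by rewrite addrK.
  exact: avB.
have h6 : 1 / 4 <= Mb * v (s^`().[y] + h * g).
  by have := ler_wpM2l (ltW Mb0) h5; move: h3 h4; rewrite mulrDr; lra.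
have h7 : v h * v (s^`().[y] + h * g) <= v s.[x] + v s.[y].
  rewrite -(avM hv) (_ : h * _ = s.[x] - s.[y]); first exact: avB.
  by rewrite sx addrAC subrr add0r.
have h8 := ler_wpM2l (ltW Mb0) h7.
have h9 := ler_wpM2l vh0 h6.
by move: h8 h9; rewrite mulrCA; lra.
Qed.

(** * The Thue-Mahler theorem *)

(* None is the archimedean place, Some p the p-adic one. *)
Definition placev (o : option nat) : rat -> rat :=
  if o is Some p then padic p else fun x => `|x|.

Definition is_place (o : option nat) : bool := if o is Some p then prime p else true.

Lemma absval_place o : is_place o -> is_absval (placev o).
Proof. by case: o => [p|_]; [exact: absval_padic | exact: absval_norm]. Qed.

Definition form_val (s : {poly int}) (x : rat) : rat :=
  (denq x)%:~R ^+ (size s).-1 * (pZtoQ s).[x].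

(* The constant C bounds the form by C * height^D, so that prox is at most 1 everywhere.
   When form_val s x is composed of the primes of S, the product of prox over S and the
   archimedean place is 1 / (C * height^D). *)
Definition prox (s : {poly int}) (C : nat) (o : option nat) (x : rat) : rat :=
  if o is Some p then padic p (form_val s x)
  else `|form_val s x| / (C%:R * (height x)%:R ^+ (size s).-1).

Definition integral_at (o : option nat) (x : rat) : bool :=
  if o is Some p then ~~ (p %| `|denq x|)%N else true.

Lemma height_gt0 x : (0 < height x)%N.
Proof. by rewrite /height leq_max !absz_gt0 denq_neq0 orbT. Qed.

Lemma denq_absz x : (denq x)%:~R = (absz (denq x))%:R :> rat.
Proof. by rewrite -[in LHS](gez0_abs (denq_ge0 x)). Qed.

Lemma height_numq x : 1 <= `|x| -> (height x)%:R = `|x| * (denq x)%:~R.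
Proof.
move=> x1; have e : `|x| * (denq x)%:~R = (absz (numq x))%:R.
  by rewrite natr_absz intr_norm numqE normrM denq_absz normr_nat.
rewrite e; congr _%:R; apply/maxn_idPl; rewrite -(ler_nat rat) -e -denq_absz.
by rewrite ler_peMl // ler0z denq_ge0.
Qed.

Lemma height_le (X : nat) x : (0 < X)%N -> `|x| <= X%:R ->
  (height x)%:R <= X%:R * (denq x)%:~R :> rat.
Proof.
move=> X0 xX; have d0 : 0 <= (denq x)%:~R :> rat by rewrite ler0z denq_ge0.
have [h|h] := leP 1 `|x|; first by rewrite height_numq // ler_wpM2r.
have : (height x <= absz (denq x))%N.
  rewrite /height geq_max leqnn andbT -(ler_nat rat) -denq_absz natr_absz intr_norm numqE normrM.
  by rewrite [`|(denq x)%:~R|]ger0_norm // -[leRHS]mul1r ler_wpM2r // ltW.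
rewrite -(ler_nat rat) -denq_absz => /le_trans; apply.
by rewrite ler_peMl // ler1n.
Qed.

Section Regime.
Variables (s : {poly int}).
Hypotheses (smon : s \is monic) (ssz : (1 < size s)%N).
Local Notation D := (size s).-1.

(** Modulo a prime dividing the denominator of x, the form reduces to the D-th power of the
    numerator, since s is monic. So a form value divisible by p makes x integral at p, and clearing
    denominators does not change the p-adic size. At a prime [prox] does not involve its constant,
    here 0. *)
Lemma regime_finite p x : prime p -> prox s 0 (Some p) x < 1 ->
  [/\ integral_at (Some p) x, padic p x <= 1 & padic p (pZtoQ s).[x] = padic p (form_val s x)].
Proof.
move=> pp; have hs : size s = D.+1 by case: (size s) ssz.
have hv := absval_padic pp.
have pn n : 0 < p%:R ^+ n :> rat by rewrite exprn_gt0 // ltr0n prime_gt0.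
have /(hom_sum x) hF : (size s <= D.+1)%N by rewrite -hs.
rewrite /prox /form_val hF; set z := \sum_(i < _) _ => pz.
have pdz : (p%:Z %| z)%Z.
  have [->|z0] := eqVneq z 0; first exact: dvdz0.
  rewrite dvdzE /= -[p]expn1 pfactor_dvdn ?absz_gt0 // lt0n.
  by apply: contraTN pz => /eqP h; rewrite padic_int // h expr0 invr1 ltxx.
have pd : ~~ (p %| `|denq x|)%N.
  apply/negP => pd; have pdZ : (p%:Z %| denq x)%Z by rewrite dvdzE.
  have : (p%:Z %| numq x ^+ D)%Z.
    move: pdz; rewrite /z big_ord_recr /= rpredDl.
      by rewrite subnn expr0 mulr1 -lead_coefE (monicP smon) mul1r.
    apply: rpred_sum => i _; rewrite dvdz_mull //.
    have : (0 < D - i)%N by rewrite subn_gt0.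
    by case: (D - i)%N => // k _; rewrite exprS dvdz_mulr.
  rewrite dvdzE abszX /= Euclid_dvdX // => /andP [pn' _].
  have : (p %| gcdn `|numq x| `|denq x|)%N by rewrite dvdn_gcd pn'.
  by rewrite (eqP (coprime_num_den x)) Euclid_dvd1.
have ld : logn p `|denq x| = 0%N.
  by apply/eqP; rewrite -leqn0 leqNgt -pfactor_dvdn ?absz_gt0 ?denq_neq0 // expn1.
have vd : padic p (denq x)%:~R = 1 by rewrite padic_int ?denq_neq0 // ld expr0 invr1.
split => //; last by rewrite -hF (avM hv) (avX hv) vd expr1n mul1r.
rewrite /padic; case: ifP => // _; rewrite ld expr0 mul1r invf_le1 //.
by rewrite -natrX ler1n expn_gt0 prime_gt0.
Qed.

(** Beyond X = 2 D c + 1 the lower terms of s amount to at most half of the leading one, which keeps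
    [prox] above 1 / (2 C). A smaller [prox] therefore confines x to a bounded interval. *)
Lemma regime_infinite (C : nat) : (0 < C)%N ->
  exists (X : nat) (e K : rat), [/\ (0 < X)%N, 0 < e, 0 < K & forall x, prox s C None x < e ->
   `|x| <= X%:R /\ `|(pZtoQ s).[x]| <= K * prox s C None x].
Proof.
move=> C0; have [c hc] := polyint_bounded s.
have hs : size s = D.+1 by case: (size s) ssz.
have D0 : (0 < D)%N by move: ssz; case: (size s) => [|[]].
have CQ : 0 < C%:R :> rat by rewrite ltr0n.
set X := (2 * (D * c)).+1.
have HD x : 0 < (height x)%:R ^+ D :> rat by rewrite exprn_gt0 // ltr0n height_gt0.
exists X, (2 * C%:R)^-1, (C%:R * X%:R ^+ D); split => //.
- by rewrite invr_gt0 mulr_gt0.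
- by rewrite mulr_gt0 // exprn_gt0 // ltr0n.
move=> x hx.
have bx : 0 <= (denq x)%:~R ^+ D :> rat by rewrite exprn_ge0 // ler0z denq_ge0.
have xX : `|x| <= X%:R.
  rewrite leNgt; apply/negP => xX; move: hx; apply/negP; rewrite -leNgt.
  have x1 : 1 <= `|x| by apply: le_trans (ltW xX); rewrite ler1n.
  have h1 : `|x| ^+ D <= `|(pZtoQ s).[x]| + (D * c)%:R * `|x| ^+ D.-1.
    have -> : `|x| ^+ D = `|(pZtoQ s).[x] - \sum_(i < D) (s`_i)%:~R * x ^+ i|.
      rewrite (@horner_coef_wide _ D.+1); last by rewrite size_rat_int_poly hs.
      rewrite big_ord_recr /=.
      under eq_bigr do rewrite coef_map /=.
      by rewrite coef_map /= -lead_coefE (monicP smon) mul1r addrAC subrr add0r normrX.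
    apply: le_trans (ler_normB _ _) _; rewrite lerD2l.
    apply: le_trans (ler_norm_sum _ _ _) _.
    apply: (@le_trans _ _ (\sum_(i < D) c%:R * `|x| ^+ D.-1)); last first.
      by rewrite sumr_const card_ord -[X in X <= _]mulr_natl natrM mulrA.
    apply: ler_sum => i _; rewrite normrM ler_pM // ?normrX.
      by rewrite -intr_norm -[c%:R]/(c%:Z%:~R) ler_int.
    by rewrite ler_weXn2l // -ltnS prednK.
  have h2 : (D * c)%:R * `|x| ^+ D.-1 <= `|x| ^+ D / 2.
    rewrite -[X in _ <= _ ^+ X / _](prednK D0) exprS mulrAC ler_wpM2r ?exprn_ge0 //.
    by move: xX; rewrite /X -natr1 natrM; lra.
  have h3 : `|x| ^+ D / 2 <= `|(pZtoQ s).[x]| by move: h1 h2; lra.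
  rewrite /prox /form_val normrM (ger0_norm bx) height_numq // exprMn.
  have bx0 : 0 < (denq x)%:~R ^+ D :> rat by rewrite exprn_gt0 // ltr0z denq_gt0.
  have xD0 : 0 < `|x| ^+ D by rewrite exprn_gt0 // (lt_le_trans ltr01).
  rewrite ler_pdivlMr ?mulr_gt0 // (_ : _ * _ = (denq x)%:~R ^+ D * (`|x| ^+ D / 2)).
    by rewrite ler_wpM2l.
  by field; rewrite gt_eqF.
split => //; rewrite /prox /form_val normrM (ger0_norm bx).
rewrite (_ : _ * (_ / _) = `|(pZtoQ s).[x]| * ((X%:R * (denq x)%:~R) ^+ D / (height x)%:R ^+ D)); last first.
  by rewrite exprMn; field; rewrite !gt_eqF ?ltr0n ?height_gt0.
rewrite ler_peMr // ler_pdivlMr // mul1r lerXn2r ?nnegrE ?mulr_ge0 ?ler0n ?ler0z ?denq_ge0 //.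
exact: height_le.
Qed.

Lemma regime (C : nat) o : (0 < C)%N -> is_place o ->
  exists (X : nat) (e K : rat), [/\ (0 < X)%N, 0 < e, 0 < K & forall x, prox s C o x < e ->
   [/\ integral_at o x, placev o x <= X%:R & placev o (pZtoQ s).[x] <= K * prox s C o x]].
Proof.
case: o => [p|] C0 pp; last first.
  have [X [e [K [X0 e0 K0 h]]]] := regime_infinite C0.
  by exists X, e, K; split => // x /h [].
exists 1%N, 1, 1; split => // x hx; have [h1 h2 h3] := regime_finite pp hx.
by split=> //; rewrite mul1r /= h3.
Qed.

End Regime.

(** Total boundedness in the form needed for pigeonhole: intervals of length 1 / L at the real
    place, residues of numerator and denominator modulo p^L at a prime. There the denominators are
    units, and p^L > L > 1 / d. *)
Lemma cells (o : option nat) (X : nat) (d : rat) : is_place o -> 0 < d ->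
  exists (T : finType) (cell : rat -> T), forall x y,
   integral_at o x -> integral_at o y -> placev o x <= X%:R -> placev o y <= X%:R ->
   cell x = cell y -> placev o (x - y) <= d.
Proof.
move=> + d0; have [L hL] : exists L : nat, d^-1 < L%:R.
  by exists (Num.trunc d^-1).+1; rewrite truncnS_gt.
case: o => [p|_] /=.
  move=> pp.
  have hv := absval_padic pp; have p1 := prime_gt1 pp.
  have pn n : 0 < p%:R ^+ n :> rat by rewrite exprn_gt0 // ltr0n prime_gt0.
  pose m := (p ^ L).-1.
  have mE : m.+1 = (p ^ L)%N by rewrite prednK // expn_gt0 prime_gt0.
  exists ('I_m.+1 * 'I_m.+1)%type, (fun x => (inord (absz (numq x %% (p ^ L)%N%:Z)%Z), inord (absz (denq x %% (p ^ L)%N%:Z)%Z))).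
  move=> x y px py _ _ [].
  have pL0 : (p ^ L)%N%:Z != 0 by rewrite -lt0n expn_gt0 prime_gt0.
  have modb a : (absz (a %% (p ^ L)%N%:Z)%Z < m.+1)%N.
    rewrite mE -ltz_nat gez0_abs ?modz_ge0 //; apply: ltz_pmod.
    by rewrite ltz_nat expn_gt0 prime_gt0.
  move=> /(congr1 val); rewrite /= !inordK // => h1.
  move=> /(congr1 val); rewrite /= !inordK // => h2.
  have {}h1 : (numq x = numq y %[mod (p ^ L)%N%:Z])%Z.
    by rewrite -[LHS]gez0_abs ?modz_ge0 // h1 gez0_abs ?modz_ge0.
  have {}h2 : (denq x = denq y %[mod (p ^ L)%N%:Z])%Z.
    by rewrite -[LHS]gez0_abs ?modz_ge0 // h2 gez0_abs ?modz_ge0.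
  have [->|xy] := eqVneq (x - y) 0; first by rewrite (av0 hv) ltW.
  have dx := denqQ_neq0 x; have dy := denqQ_neq0 y.
  have e : x - y = (numq x * denq y - numq y * denq x)%:~R / (denq x * denq y)%:~R.
    by rewrite rmorphB !rmorphM /= !numqE; field; rewrite dx dy.
  have dv : (p ^ L %| `|(numq x * denq y - numq y * denq x)%R|)%N.
    rewrite -[(p ^ L)%N]/(absz (p ^ L)%N%:Z) -dvdzE -eqz_mod_dvd; apply/eqP.
    by rewrite -modzMml h1 modzMml -modzMmr -h2 modzMmr.
  have dn0 : denq x * denq y != 0 by rewrite mulf_neq0 ?denq_neq0.
  apply: le_trans (padic_le pp xy dn0 e dv) _.
  have -> : logn p `|(denq x * denq y)%R| = 0%N.
    rewrite abszM lognM ?absz_gt0 ?denq_neq0 //.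
    by rewrite lognE (negPf px) !andbF lognE (negPf py) !andbF.
  rewrite expr0 mul1r -[d]invrK lef_pV2 ?posrE ?invr_gt0 //.
  apply: le_trans (ltW hL) _; rewrite -natrX ler_nat; apply/ltnW/ltn_expl => //.
exists 'I_(2 * X * L).+1, (fun x => inord (Num.trunc ((x + X%:R) * L%:R))).
move=> x y _ _; rewrite !ler_norml => /andP [x1 x2] /andP [y1 y2].
have L0 : 0 < L%:R :> rat by apply: lt_trans hL; rewrite invr_gt0.
have nn (z : rat) : - X%:R <= z -> 0 <= (z + X%:R) * L%:R by move=> h; rewrite mulr_ge0 ?(ltW L0) // -lerBlDr sub0r.
have tb (z : rat) : - X%:R <= z -> z <= X%:R -> (Num.trunc ((z + X%:R) * L%:R) < (2 * X * L).+1)%N.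
  move=> h1 h2; rewrite ltnS -(ler_nat rat); apply: le_trans (_ : (z + X%:R) * L%:R <= _).
    by have /andP [] := truncn_itv (nn _ h1).
  by rewrite [leRHS]natrM ler_wpM2r ?(ltW L0) // mul2n -addnn natrD lerD.
move=> /(congr1 val); rewrite /= !inordK ?tb // => ht.
have /andP [a1 a2] := truncn_itv (nn _ x1).
have /andP [b1 b2] := truncn_itv (nn _ y1).
rewrite ht in a1 a2; rewrite -natr1 in a2 b2.
have dL : 1 <= d * L%:R.
  by rewrite -ler_pdivrMl // mulr1 ltW.
move: a1 a2 b1 b2 dL; rewrite !mulrDl => *.
by apply/andP; split; rewrite -(ler_pM2r L0); lra.
Qed.

Definition unbounded (E : rat -> Prop) : Prop :=
  forall N : nat, exists2 x, E x & (N < height x)%N.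

Lemma unbounded_pigeonhole (T : finType) (f : rat -> T) (E : rat -> Prop) :
  unbounded E -> exists t, unbounded (fun x => E x /\ f x = t).
Proof.
move=> Einf; apply: NNPP => h.
have /fin_all_exists [N hN] t : exists N : nat, forall x, E x -> f x = t -> (height x <= N)%N.
  apply: NNPP => ht; apply: h; exists t => N; apply: NNPP => hN; apply: ht.
  by exists N => x Ex fx; rewrite leqNgt; apply/negP => hx; apply: hN; exists x.
have [x Ex hx] := Einf (\max_t N t)%N.
have := leq_trans hx (hN _ _ Ex erefl).
by rewrite ltnNge leq_bigmax.
Qed.

Lemma unbounded_filter (N : nat) (E : rat -> Prop) :
  unbounded E -> unbounded (fun x => E x /\ (N < height x)%N).
Proof.
move=> Einf M; have [x Ex] := Einf (maxn N M); rewrite gtn_max => /andP [h1 h2].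
by exists x.
Qed.

Section Places.
Variables (s : {poly int}) (Cs K : nat).
Hypotheses (smon : s \is monic) (ssz : (1 < size s)%N) (ssep : separable_poly (pZtoQ s)).
Hypothesis (Cs0 : (0 < Cs)%N).
Hypothesis form_le : forall x, `|form_val s x| <= Cs%:R * (height x)%:R ^+ (size s).-1.
Local Notation D := (size s).-1.

(* On E, prox at the place o is about height^(-k/K) (k being capped at D K), and if
   k > 0 the elements of E all approach the same root of s. *)
Definition tame (o : option nat) (k : nat) (E : rat -> Prop) : Prop :=
  (forall x, E x -> prox s Cs o x ^+ K * (height x)%:R ^+ k <= 1 /\
    ((k < D * K)%N -> 1 < prox s Cs o x ^+ K * (height x)%:R ^+ k.+1)) /\
  ((0 < k)%N -> exists X C : nat, [/\ (0 < X)%N,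
    forall x, E x -> placev o x <= X%:R /\
      placev o (pZtoQ s).[x] <= C%:R * prox s Cs o x
    & forall x y, E x -> E y ->
      placev o (x - y) <= C%:R * (prox s Cs o x + prox s Cs o y)]).

Lemma tame_sub o k (E E' : rat -> Prop) : (forall x, E' x -> E x) -> tame o k E -> tame o k E'.
Proof.
move=> sub [h1 h2]; split=> [x /sub /h1 //|k0].
by have [X [C [X0 a b]]] := h2 k0; exists X, C; split=> // [x /sub /a|x y /sub ? /sub ?]; auto.
Qed.

Lemma prox_ge0 o x : is_place o -> 0 <= prox s Cs o x.
Proof.
case: o => [p|] /= h; first by rewrite (av_ge0 (absval_padic h)).
by rewrite divr_ge0 // mulr_ge0 ?exprn_ge0.
Qed.

Lemma padic_int_le1 p (z : int) : prime p -> padic p z%:~R <= 1.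
Proof.
move=> pp; have [->|z0] := eqVneq z 0; first by rewrite (av0 (absval_padic pp)).
have p0 := prime_gt0 pp.
by rewrite padic_int // invf_le1 -?natrX ?ler1n ?ltr0n expn_gt0 p0.
Qed.

Lemma form_val_int x : exists z : int, form_val s x = z%:~R.
Proof.
have [B hB] := polyint_bounded s.
have [|z hz _] := @hom_int s D B x _ hB; first exact: leqSpred.
by exists z.
Qed.

Lemma prox_le1 o x : is_place o -> prox s Cs o x <= 1.
Proof.
case: o => [p|] /= h.
  by have [z ->] := form_val_int x; apply: padic_int_le1.
rewrite ler_pdivrMr ?mul1r // mulr_gt0 ?ltr0n // exprn_gt0 // ltr0n height_gt0 //.
Qed.

Lemma rat_le_nat (r : rat) : exists n : nat, r <= n%:R.
Proof.
by exists (Num.trunc r).+1; rewrite ltW // truncnS_gt.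
Qed.

(** The largest admissible k works, and k = 0 is admissible because [prox] is at most 1. The cap D K
    keeps the exponent in a finite type for the pigeonhole, even if [prox] is 0. *)
Lemma bucket o x : is_place o -> exists k : 'I_(D * K).+1,
  (prox s Cs o x ^+ K * (height x)%:R ^+ k <= 1) &&
  ((k < D * K)%N ==> (1 < prox s Cs o x ^+ K * (height x)%:R ^+ k.+1)).
Proof.
move=> oP; pose P k := (k <= D * K)%N && (prox s Cs o x ^+ K * (height x)%:R ^+ k <= 1).
have P0 : P 0%N.
  by rewrite /P /= expr0 mulr1 exprn_ile1 ?prox_ge0 ?prox_le1.
have Pb k : P k -> (k <= D * K)%N by case/andP.
have exP : exists k, P k by exists 0%N.
case: (ex_maxnP exP Pb) => k /andP [kD hk] kmax.
exists (Ordinal (kD : (k < (D * K).+1)%N)); rewrite /= hk /=; apply/implyP => kD'.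
by rewrite ltNge; apply/negP => h; have := kmax k.+1; rewrite /P kD' h ltnn => /(_ isT).
Qed.

(** Pigeonhole fixes the exponent k. For k > 0, [prox] tends to 0 as the height grows, so discarding
    small heights brings every element into the range of [regime]. A second pigeonhole over [cells]
    makes the elements mutually close, and [close_bound] sharpens this to the order of [prox]. *)
Lemma tame_refine o (E : rat -> Prop) : is_place o -> unbounded E ->
  exists k (E' : rat -> Prop), [/\ unbounded E', forall x, E' x -> E x & tame o k E'].
Proof.
move=> oP Einf; have hv := absval_place oP.
have [f hf] : exists f : rat -> 'I_(D * K).+1, forall x,
  (prox s Cs o x ^+ K * (height x)%:R ^+ f x <= 1) &&
  ((f x < D * K)%N ==> (1 < prox s Cs o x ^+ K * (height x)%:R ^+ (f x).+1)).
  by exists (fun x => xchoose (bucket x oP)) => x; apply: (xchooseP (bucket x oP)).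
have [k E1] := unbounded_pigeonhole f Einf.
have hE1 x : E x /\ f x = k -> prox s Cs o x ^+ K * (height x)%:R ^+ k <= 1 /\
    ((k < D * K)%N -> 1 < prox s Cs o x ^+ K * (height x)%:R ^+ k.+1).
  by move=> [_ <-]; have /andP [h1 /implyP h2] := hf x.
have [k0|k0] := posnP k.
  exists k, (fun x => E x /\ f x = k); split => // [x []//|].
  by split=> //; rewrite k0.
have [X [e [C [X0 e0 C0 hreg]]]] := regime smon ssz Cs0 oP.
have [d [t [C2 [d0 t0 C20 hclose]]]] := close_bound X hv ssep.
(* [e] is the threshold of [regime]; t / C puts v(s(x)) below the threshold [t] of [close_bound].
   From prox^K <= 1 / height, heights above [N] reach both. *)
pose e' := Num.min e (t / C); have e'0 : 0 < e' by rewrite lt_min e0 divr_gt0.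
have [N hN] := rat_le_nat ((e' ^+ K)^-1).
have [T [cell hcell]] := cells X oP d0.
have E2 := unbounded_filter N E1.
have [c E3] := unbounded_pigeonhole cell E2.
have [n1 hn1] := rat_le_nat C; have [n2 hn2] := rat_le_nat (C2 * C).
set E' := (fun x => _) in E3; exists k, E'; split => //; first by move=> x [[[]]].
split => [x [[h _] _]|_]; first exact: hE1.
have small x : E' x -> prox s Cs o x < e'.
  move=> [[h hx] _]; have [h1 _] := hE1 x h; have p0 := prox_ge0 x oP.
  rewrite ltNge; apply/negP => hp; move: h1; apply/negP; rewrite -ltNge.
  apply: (@lt_le_trans _ _ (e' ^+ K * (height x)%:R)).
    rewrite -ltr_pdivrMl ?exprn_gt0 // mulr1.
    by apply: le_lt_trans hN _; rewrite ltr_nat.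
  apply: ler_pM; rewrite ?exprn_ge0 ?ler0n ?(ltW e'0) //.
    by rewrite lerXn2r ?nnegrE ?(ltW e'0).
  by rewrite -natrX ler_nat -[X in (X <= _)%N]expn1 leq_pexp2l // height_gt0.
have hE' x : E' x -> [/\ integral_at o x, placev o x <= X%:R,
   placev o (pZtoQ s).[x] <= C * prox s Cs o x & placev o (pZtoQ s).[x] <= t].
  move=> Ex; have sx := small x Ex; have := sx; rewrite lt_min => /andP [h1 h2].
  have [a1 a2 a3] := hreg x h1; split => //.
  by apply: le_trans a3 _; rewrite mulrC -ler_pdivlMr // ltW.
exists X, (maxn n1 n2); split => // [x Ex|x y Ex Ey].
  have [_ a2 a3 _] := hE' x Ex; split => //; apply: le_trans a3 _.
  by rewrite ler_wpM2r ?prox_ge0 // (le_trans hn1) // ler_nat leq_maxl.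
have [a1 a2 a3 _] := hE' x Ex; have [b1 b2 b3 b4] := hE' y Ey.
have cxy : cell x = cell y by case: Ex => _ ->; case: Ey => _ ->.
apply: le_trans (hclose x y a2 b2 b4 (hcell x y a1 b1 a2 b2 cxy)) _.
apply: (@le_trans _ _ (C2 * C * (prox s Cs o x + prox s Cs o y))).
  by rewrite -mulrA ler_wpM2l ?(ltW C20) // mulrDr lerD.
rewrite ler_wpM2r ?addr_ge0 ?prox_ge0 // (le_trans hn2) // ler_nat leq_maxr //.
Qed.

Lemma tame_refine_seq (L : seq (option nat)) (E : rat -> Prop) :
  all is_place L -> unbounded E ->
  exists (k : option nat -> nat) (E' : rat -> Prop),
    [/\ unbounded E', forall x, E' x -> E x & forall o, o \in L -> tame o (k o) E'].
Proof.
move=> + Einf; elim: L => [_|o L IH /= /andP [oP /IH]]; first by exists (fun=> 0%N), E.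
move=> [k [E1 [i1 sub1 t1]]]; have [k' [E2 [i2 sub2 t2]]] := tame_refine oP i1.
exists (fun o' => if o' == o then k' else k o'), E2; split => // [x /sub2 /sub1 //|o'].
by rewrite inE; case: eqVneq => [->|] //= _ /t1; apply: tame_sub.
Qed.

End Places.

Definition aux_val (s U V : {poly int}) (q j : nat) (x y : rat) : rat :=
  (denq x)%:~R ^+ (13 * q * (size s).-1) * (denq y)%:~R *
  ((pZtoQ U)^`N(j).[x] + y * (pZtoQ V)^`N(j).[x]).

Lemma aux_val_int (s : {poly int}) (c : nat) : exists2 C : nat, (0 < C)%N & forall q U V j x y,
  (0 < q)%N -> aux_pair s c q U V ->
  exists2 z : int, aux_val s U V q j x y = z%:~R &
   `|z| <= (C ^ q * (height x ^ (13 * q * (size s).-1) * height y))%N%:Z.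
Proof.
pose r q := (13 * q * (size s).-1)%N.
pose E q := (2 * ((r q).+1 * (2 ^ (r q).+1 * c ^ q)))%N.
have [C hC] : expb E.
  have rb q : (0 < q)%N -> ((r q).+1 <= (13 * (size s).-1 + 1) * q)%N by rewrite /r; nia.
  have qb q : (0 < q)%N -> (q <= 1 * q)%N by lia.
  exact: (expbM (expb_const 2) (expbM (expb_linear rb) (expbM (expbX 2 rb) (expbX c qb)))).
exists C.+1 => // q U V j x y q0 [[sU sV] _ UVc _].
have sN (p : {poly int}) : (size p <= (r q).+1)%N -> (size p^`N(j) <= (r q).+1)%N.
  by move=> sp; apply/leq_sizeP => i hi; rewrite coef_nderivn nth_default ?mul0rn // (leq_trans sp) // (leq_trans hi) // leq_addl.
have [u hu ub] := hom_int x (sN U sU) (nderivn_coef_bound j sU (fun i => (UVc i).1)).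
have [w hw wb] := hom_int x (sN V sV) (nderivn_coef_bound j sV (fun i => (UVc i).2)).
exists (denq y * u + numq y * w).
  rewrite rmorphD !rmorphM /= -hu -hw /aux_val !nderivn_map numqE -/(r q).
  by ring.
apply: le_trans (ler_normD _ _) _; rewrite !normrM.
have hd : `|denq y| <= (height y)%:Z by rewrite -abszE lez_nat leq_maxr.
have hn : `|numq y| <= (height y)%:Z by rewrite -abszE lez_nat leq_maxl.
have h1 := ler_pM (normr_ge0 _) (normr_ge0 _) hd ub.
have h2 := ler_pM (normr_ge0 _) (normr_ge0 _) hn wb.
apply: le_trans (lerD h1 h2) _; rewrite -PoszM -PoszD lez_nat.
apply: (@leq_trans (E q * (height x ^ r q * height y))); last first.
  by rewrite leq_mul // (leq_trans (hC _ q0)) // leq_wexp2r.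
by rewrite /E; apply: eq_leq; ring.
Qed.

Section PlaceEstimate.
Variables (s : {poly int}) (Cs K c : nat).
Hypotheses (smon : s \is monic) (K0 : (0 < K)%N).

(** The factors that clear denominators are integers: they do not increase a p-adic value, so their
    size is paid at the real place only. *)
Definition arch_part (o : option nat) (z : rat) : rat := if o is Some _ then 1 else z.

Lemma powD_le (a b A : rat) n : 0 <= a -> 0 <= b -> a ^+ n <= A -> b ^+ n <= A ->
  (a + b) ^+ n <= 2 ^+ n * A.
Proof.
move=> a0 b0 ha hb; wlog ab : a b a0 b0 ha hb / a <= b.
  by move=> h; case: (leP a b) => [/h|/ltW /h]; [|rewrite addrC]; apply.
apply: (@le_trans _ _ ((2 * b) ^+ n)).
  by rewrite lerXn2r ?nnegrE ?addr_ge0 ?mulr_ge0 //; lra.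
by rewrite exprMn ler_wpM2l ?exprn_ge0.
Qed.

(** For k = 0 the place contributes nothing and the trivial bound on an integer is used. For k > 0,
    both terms of [local_estimate] are small: v(x - y) is governed by height(x)^(-k/K), and v(s(y))
    by height(y)^(-k/K), which is at most height(x)^(-24 q k/K). *)
Lemma place_estimate o k E : is_place o -> tame s Cs K o k E ->
  exists C : nat, forall q U V j x y, (0 < q)%N -> aux_pair s c q U V -> (j <= q)%N ->
  E x -> E y -> (height x ^ (24 * q) <= height y)%N ->
  placev o (aux_val s U V q j x y) ^+ K * (height x)%:R ^+ (k * (24 * q - j)) <=
   (C ^ q)%:R * arch_part o ((height x)%:R ^+ (13 * q * (size s).-1) * (height y)%:R) ^+ K.
Proof.
move=> oP [hk htame]; have hv := absval_place oP.
have [k0|k0] := posnP k.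
  have [C C0 hC] := aux_val_int s c; exists (C ^ K)%N => q U V j x y q0 UV jq Ex Ey hxy.
  have [z -> zb] := hC q U V j x y q0 UV; rewrite k0 mul0n expr0 mulr1.
  apply: (@le_trans _ _ (((C ^ q)%:R * arch_part o ((height x)%:R ^+ (13 * q * (size s).-1) * (height y)%:R)) ^+ K)).
    rewrite lerXn2r ?nnegrE ?(av_ge0 hv) //.
      by rewrite mulr_ge0 //; case: (o) => [p|] //=; rewrite mulr_ge0 ?exprn_ge0.
    case: o oP {hk htame hv} => [p|] /= pp.
      by rewrite mulr1 (le_trans (padic_int_le1 z pp)) // ler1n expn_gt0 C0.
    by rewrite -intr_norm -natrX -!natrM; move: zb; rewrite -(ler_int rat).
  suff -> : ((C ^ K) ^ q)%:R = (C ^ q)%:R ^+ K :> rat by rewrite exprMn.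
  by rewrite -natrX -!expnM mulnC.
have [X [C1 [X0 hx hxy']]] := htame k0.
have [C2 hC2] := local_estimate c smon X0.
pose c1 := C1.+1.
pose F q := (C2 ^ (q * K) * (2 ^ K * (c1 ^ K + (2 * c1) ^ (24 * q * K))))%N.
have [C hC] : expb F.
  have b1 q : (0 < q)%N -> (q * K <= K * q)%N by rewrite mulnC.
  have b2 q : (0 < q)%N -> (24 * q * K <= (24 * K) * q)%N by lia.
  exact: (expbM (expbX C2 b1) (expbM (expb_const _) (expbD (expb_const _) (expbX (2 * c1) b2)))).
exists C => q U V j x y q0 UV jq Ex Ey Hxy.
have [vx _] := hx x Ex; have [vy vsy] := hx y Ey.
have est := hC2 q U V q0 UV _ x y j hv vx vy jq.
set m := (24 * q)%N in est *; set T := _ + y * _ in est.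
set H1 := (height x)%:R : rat; set H2 := (height y)%:R : rat.
have H1ge1 : 1 <= H1 by rewrite ler1n height_gt0.
have H12 : H1 ^+ m <= H2 by rewrite /H1 /H2 -natrX ler_nat.
have H2ge1 : 1 <= H2 by rewrite ler1n height_gt0.
have H1leH2 : H1 <= H2 by apply: le_trans H12; rewrite -[leLHS]expr1 ler_weXn2l // /m; lia.
have px0 := prox_ge0 s Cs x oP; have py0 := prox_ge0 s Cs y oP.
set px := prox s Cs o x in px0 *; set py := prox s Cs o y in py0 vsy *.
have [hpx _] := hk x Ex; have [hpy _] := hk y Ey.
rewrite -/px -/H1 in hpx; rewrite -/py -/H2 in hpy.
have c1Q : 1 <= c1%:R :> rat by rewrite ler1n.
have C1c1 : C1%:R <= c1%:R :> rat by rewrite ler_nat.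
have H1gt0 : 0 < H1 by apply: lt_le_trans H1ge1.
set A := H1 ^+ (k * (m - j)); have A0 : 0 < A by rewrite exprn_gt0.
set al := placev o _ in vsy est; set w := placev o (x - y) in est.
have al0 : 0 <= al := av_ge0 hv _; have w0 : 0 <= w := av_ge0 hv _.
have hal : al ^+ K * A <= c1%:R ^+ K.
  apply: (@le_trans _ _ ((c1%:R * py) ^+ K * H2 ^+ k)).
    apply: ler_pM; rewrite ?exprn_ge0 ?(ltW A0) //.
      rewrite lerXn2r ?nnegrE ?mulr_ge0 ?ler0n //; apply: le_trans vsy _.
      by rewrite ler_wpM2r.
    rewrite /A mulnC exprM lerXn2r ?nnegrE ?exprn_ge0 ?(ltW H1gt0) ?(le_trans ler01 H2ge1) //.
    by apply: le_trans H12; rewrite ler_weXn2l // leq_subr.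
  by rewrite exprMn -mulrA -[leRHS]mulr1 ler_wpM2l // exprn_ge0.
have hpP : (px + py) ^+ K * H1 ^+ k <= 2 ^+ K.
  rewrite -ler_pdivlMr ?exprn_gt0 //; apply: powD_le => //.
    by rewrite -[_^-1]mul1r ler_pdivlMr ?exprn_gt0.
  rewrite -[_^-1]mul1r ler_pdivlMr ?exprn_gt0 //; apply: le_trans hpy.
  by rewrite ler_wpM2l ?exprn_ge0 // lerXn2r ?nnegrE ?(ltW H1gt0) ?(le_trans ler01 H2ge1).
have hw : w ^+ K * H1 ^+ k <= (2 * c1)%:R ^+ K.
  apply: (@le_trans _ _ ((c1%:R * (px + py)) ^+ K * H1 ^+ k)).
    rewrite ler_wpM2r ?exprn_ge0 ?(ltW H1gt0) // lerXn2r ?nnegrE ?mulr_ge0 ?addr_ge0 ?ler0n //.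
    by apply: le_trans (hxy' x y Ex Ey) _; rewrite ler_wpM2r ?addr_ge0.
  by rewrite exprMn -mulrA mulnC natrM exprMn ler_wpM2l ?exprn_ge0.
have hbe : (w ^+ (m - j)) ^+ K * A <= (2 * c1)%:R ^+ (m * K).
  apply: (@le_trans _ _ (((2 * c1)%:R ^+ K) ^+ (m - j))).
    rewrite /A exprM -exprM [(_ * K)%N]mulnC exprM -exprMn.
    by rewrite lerXn2r ?nnegrE ?exprn_ge0 ?ler0n ?mulr_ge0 ?exprn_ge0 ?(ltW H1gt0).
  by rewrite -exprM [(K * _)%N]mulnC ler_weXn2l ?ler1n ?muln_gt0 // leq_mul2r leq_subr orbT.
have hsum : (al + w ^+ (m - j)) ^+ K * A <= 2 ^+ K * (c1%:R ^+ K + (2 * c1)%:R ^+ (m * K)).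
  rewrite -ler_pdivlMr // -mulrA; apply: powD_le; rewrite ?exprn_ge0 // ler_pdivlMr //.
    by apply: le_trans hal _; rewrite lerDl exprn_ge0.
  by apply: le_trans hbe _; rewrite lerDr exprn_ge0.
set AP := arch_part o _.
have hb : placev o ((denq x)%:~R ^+ (13 * q * (size s).-1) * (denq y)%:~R) <= AP.
  rewrite /AP; case: (o) oP => [p|] /= pp; first by rewrite -rmorphXn -rmorphM padic_int_le1.
  rewrite normrM normrX !denq_absz !normr_nat ler_pM ?exprn_ge0 //.
    by rewrite lerXn2r ?nnegrE // ler_nat leq_maxr.
  by rewrite ler_nat leq_maxr.
have AP0 : 0 <= AP by apply: le_trans hb; apply: av_ge0.
have hfin : placev o (aux_val s U V q j x y) <= AP * ((C2 ^ q)%:R * (al + w ^+ (m - j))).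
  by rewrite /aux_val (avM hv) ler_pM ?(av_ge0 hv).
have aw0 : 0 <= al + w ^+ (m - j) by rewrite addr_ge0 ?exprn_ge0.
apply: (@le_trans _ _ ((AP * ((C2 ^ q)%:R * (al + w ^+ (m - j)))) ^+ K * A)).
  by rewrite ler_wpM2r ?(ltW A0) // lerXn2r ?nnegrE ?(av_ge0 hv) ?mulr_ge0.
have -> : (AP * ((C2 ^ q)%:R * (al + w ^+ (m - j)))) ^+ K * A =
  AP ^+ K * ((C2 ^ q)%:R ^+ K * ((al + w ^+ (m - j)) ^+ K * A)).
  by rewrite !exprMn -!mulrA.
rewrite [leRHS]mulrC; apply: (@le_trans _ _ (AP ^+ K * (F q)%:R)); last first.
  by rewrite ler_wpM2l ?exprn_ge0 // ler_nat hC.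
rewrite ler_wpM2l ?exprn_ge0 // /F natrM expnM [X in _ <= X * _]natrX ler_wpM2l ?exprn_ge0 //.
by rewrite natrM natrD !natrX.
Qed.

End PlaceEstimate.

Lemma factor_primes (ps : seq nat) (n : nat) : uniq ps -> all prime ps -> (0 < n)%N ->
  exists2 m, n = (m * \prod_(p <- ps) p ^ logn p n)%N & forall p, p \in ps -> ~~ (p %| m)%N.
Proof.
move=> + + n0; elim: ps => [|p ps IH] /=; first by exists n; rewrite ?big_nil ?muln1.
move=> /andP [pps ups] /andP [pp aps]; have [m nm hm] := IH ups aps.
set P := (\prod_(p <- ps) _)%N in nm.
have m0 : (0 < m)%N by move: n0; rewrite nm muln_gt0 => /andP [].
have [m' cm' mm'] := pfactor_coprime pp m0.
have P0 : (0 < P)%N by move: n0; rewrite nm muln_gt0 => /andP [].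
have lP : logn p P = 0%N.
  apply/eqP; rewrite -leqn0 leqNgt -pfactor_dvdn // expn1 /P.
  apply/negP => h; have : has (fun q => p %| q ^ logn q n)%N ps.
    move: h; elim: (ps) => [|r rs IHr] /=; first by rewrite big_nil Euclid_dvd1.
    by rewrite big_cons Euclid_dvdM // => /orP [->|/IHr ->]; rewrite ?orbT.
  move=> /hasP [q qps]; rewrite Euclid_dvdX // => /andP [pq _].
  have := allP aps _ qps => qp; move: pq; rewrite dvdn_prime2 // => /eqP e.
  by move: pps; rewrite e qps.
exists m'; last first.
  move=> q; rewrite inE => /orP [/eqP ->|qps]; first by rewrite -prime_coprime.
  by apply: contra (hm q qps) => h; rewrite mm' dvdn_mulr.
by rewrite big_cons mulnA -/P {2}nm lognM // lP addn0 -mm'.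
Qed.

Lemma prod_padic (ps : seq nat) (z : int) : all prime ps -> z != 0 ->
  \prod_(p <- ps) padic p z%:~R = ((\prod_(p <- ps) p ^ logn p `|z|)%N%:R)^-1.
Proof.
move=> + z0; elim: ps => [|p ps IH] /=; first by rewrite !big_nil invr1.
by move=> /andP [pp /IH h]; rewrite !big_cons h padic_int // natrM invfM natrX.
Qed.

(** The product is the part of |z| prime to [ps], a positive integer. Applied to the auxiliary
    value, this is the lower bound that the product of the place estimates will contradict. *)
Lemma prod_padic_ge1 (ps : seq nat) (z : int) : uniq ps -> all prime ps -> z != 0 ->
  1 <= `|z%:~R| * \prod_(p <- ps) padic p z%:~R.
Proof.
move=> ups aps z0; have z0' : (0 < `|z|)%N by rewrite absz_gt0.
have [m e _] := factor_primes ups aps z0'.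
rewrite prod_padic // -intr_norm -natr_absz {1}e natrM mulfK.
  by rewrite ler1n lt0n; apply: contraTneq z0' => h; rewrite e h.
by rewrite pnatr_eq0; apply: contraTneq z0' => h; rewrite e h muln0.
Qed.

Lemma prod_padic_eq1 (ps : seq nat) (z : int) : uniq ps -> all prime ps -> z != 0 ->
  (forall p, prime p -> (p %| `|z|)%N -> p \in ps) ->
  `|z%:~R| * \prod_(p <- ps) padic p z%:~R = 1.
Proof.
move=> ups aps z0 hz; have z0' : (0 < `|z|)%N by rewrite absz_gt0.
have [m e hm] := factor_primes ups aps z0'.
have m1 : m = 1%N.
  apply/eqP; apply: contraT => m1.
  have mm : (pdiv m %| `|z|)%N by rewrite e dvdn_mulr // pdiv_dvd.
  have m_gt1 : (1 < m)%N.
    by case: m m1 e {hm mm} => [|[]] // _ h; move: z0'; rewrite h.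
  by have := hm _ (hz _ (pdiv_prime m_gt1) mm); rewrite pdiv_dvd.
rewrite prod_padic // -intr_norm -natr_absz {1}e m1 mul1n mulfV //.
by rewrite pnatr_eq0; apply: contraTneq z0' => h; rewrite e h muln0.
Qed.

(** Differentiation lowers 24 q to at worst 23 q, and rounding at l places lowers D K = 23 D l by l.
    After division by l the claim is 598 q + 552 <= 230 D q, an equality at D = 3, q = 6; hence K =
    23 l and q >= 6. *)
Lemma thue_mahler_exponent (D q l K kap j : nat) : (2 < D)%N -> (5 < q)%N -> K = (23 * l)%N ->
  (j <= q)%N -> (D * K <= kap + l)%N ->
  ((13 * q * D + (24 * q + 24)) * K + q * K <= kap * (24 * q - j))%N.
Proof.
move=> D2 q5 -> jq hk.
apply: (@leq_trans ((D * (23 * l) - l) * (23 * q))); last by apply: leq_mul; lia.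
have -> : (D * (23 * l) - l = (23 * D - 1) * l)%N by rewrite mulnBl; lia.
have : ((13 * q * D + (24 * q + 24)) * 23 + q * 23 <= (23 * D - 1) * (23 * q))%N.
  have -> : ((23 * D - 1) * (23 * q) = 529 * (D * q) - 23 * q)%N by rewrite mulnBl; lia.
  have : (3 * q <= D * q)%N by rewrite leq_mul2r D2 orbT.
  by lia.
move: (_ - 1)%N => a h; have := leq_mul h (leqnn l); nia.
Qed.

(** Form values are computed in Q; the quantified [z] recovers the integer that such a value is. *)
Definition has_primes_in (M : nat) (r : rat) : Prop :=
  forall (p : nat) (z : int), r = z%:~R -> prime p -> (p %| `|z|)%N -> (p %| M)%N.

Lemma thue_mahler_monic (s : {poly int}) (M : nat) :
  s \is monic -> (3 < size s)%N -> separable_poly (pZtoQ s) -> (0 < M)%N ->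
  exists N, forall x, form_val s x != 0 -> has_primes_in M (form_val s x) ->
    (height x <= N)%N.
Proof.
move=> smon s3 ssep M0; set D := (size s).-1.
have ssz : (1 < size s)%N by apply: ltn_trans s3.
have D2 : (2 < D)%N by rewrite /D; case: (size s) s3.
apply: NNPP => hN; pose E x := form_val s x != 0 /\ has_primes_in M (form_val s x).
have Einf : unbounded E.
  move=> N; apply: NNPP => h; apply: hN; exists N => x h1 h2; rewrite leqNgt.
  by apply/negP => h3; apply: h; exists x.
have [B hB] := polyint_bounded s.
pose Cs := (D.+1 * B).+1.
have form_le x : `|form_val s x| <= Cs%:R * (height x)%:R ^+ D.
  have [|z hz zb] := @hom_int s D B x _ hB; first exact: leqSpred.
  rewrite /form_val -/D hz -intr_norm; apply: (@le_trans _ _ (D.+1 * (B * height x ^ D))%N%:R).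
    by rewrite -[leRHS]/((D.+1 * (B * height x ^ D))%N%:Z%:~R) ler_int.
  by rewrite -natrX -natrM ler_nat mulnA leq_mul.
pose ps := primes M; pose L : seq (option nat) := None :: map Some ps.
pose l := size L; pose K := (23 * l)%N.
have K0 : (0 < K)%N by [].
have ups : uniq ps := primes_uniq M.
have aps : all prime ps by apply/allP => p; rewrite mem_primes => /andP [].
have aL : all is_place L by rewrite /= all_map.
have [k [E1 [E1inf E1sub htame]]] := tame_refine_seq K smon ssz ssep (isT : (0 < Cs)%N) form_le aL Einf.
have prox_prod x : E x -> \prod_(o <- L) prox s Cs o x = (Cs%:R * (height x)%:R ^+ D)^-1.
  move=> [f0 fM]; rewrite big_cons big_map /= mulrAC.
  have [z hz] := form_val_int s x.
  have -> : `|form_val s x| * \prod_(p <- ps) padic p (form_val s x) = 1; last by rewrite mul1r.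
  have z0 : z != 0 by apply: contraNneq f0 => h; rewrite hz h.
  rewrite hz prod_padic_eq1 // => p pp pz.
  by rewrite mem_primes pp M0 (fM p z).
pose kap := (\sum_(o <- L) k o)%N.
(* Unless some k reaches the cap, multiplying the lower bounds 1 < prox^K H^(k+1) over all places
   and inserting the product of the [prox] gives H^(D K) <= H^(kap + l). *)
have hkap : (D * K <= kap + l)%N.
  have [/hasP [o oL ko]|] := boolP (has (fun o => D * K <= k o)%N L).
    by apply: leq_trans ko _; rewrite /kap (big_rem o oL) /= -addnA leq_addr.
  rewrite -all_predC => /allP kL.
  have [x Ex hx] := E1inf 1%N.
  have HQ : 0 < (height x)%:R :> rat by rewrite ltr0n height_gt0.
  have h1 : 1 <= \prod_(o <- L) (prox s Cs o x ^+ K * (height x)%:R ^+ (k o).+1).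
    rewrite big_seq; apply: (big_ind (fun z : rat => 1 <= z)) => // [a b a1 b1|o oL].
      by rewrite -[1]mulr1 ler_pM.
    have [h _] := htame o oL; have [_ h2] := h x Ex; apply/ltW/h2.
    by have := kL o oL; rewrite /= -ltnNge.
  rewrite big_split /= prodrXl prox_prod // in h1; last exact: E1sub.
  have h2 : \prod_(o <- L) (height x)%:R ^+ (k o).+1 = (height x)%:R ^+ (kap + l) :> rat.
    rewrite /kap /l; elim: (L) => [|o L' IH]; first by rewrite !big_nil expr0.
    by rewrite !big_cons IH -exprD /=; congr (_ ^+ _); lia.
  rewrite h2 exprVn mulrC ler_pdivlMr ?mul1r in h1; last first.
    by rewrite exprn_gt0 // mulr_gt0 ?ltr0n // exprn_gt0.
  rewrite -(leq_exp2l _ _ hx) -(ler_nat rat); apply: le_trans (_ : (Cs%:R * (height x)%:R ^+ D) ^+ K <= _).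
    rewrite exprMn -exprM natrX ler_peMl ?exprn_ge0 // ?ler0n //.
    by rewrite exprn_ege1 // ler1n.
  by rewrite natrX.
have [c hc] := aux_pair_exists smon ssz.
have [C0 hC0] := aux_nonvanish c ssep s3.
pose est o C := forall q U V j x y, (0 < q)%N -> aux_pair s c q U V -> (j <= q)%N ->
  E1 x -> E1 y -> (height x ^ (24 * q) <= height y)%N ->
  placev o (aux_val s U V q j x y) ^+ K * (height x)%:R ^+ (k o * (24 * q - j)) <=
   (C ^ q)%:R * arch_part o ((height x)%:R ^+ (13 * q * (size s).-1) * (height y)%:R) ^+ K.
have estS o C C' : (C <= C')%N -> est o C -> est o C'.
  move=> CC h q U V j x y q0 UV jq Ex Ey hxy; apply: le_trans (h q U V j x y q0 UV jq Ex Ey hxy) _.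
  apply: ler_wpM2r; last by rewrite ler_nat leq_wexp2r.
  by case: (o) => [p|] /=; rewrite exprn_ge0 // mulr_ge0 ?exprn_ge0.
have [C hC] : exists C, forall o, o \in L -> est o C.
  move: (L) aL htame; elim=> [|o L' IH] /=; first by exists 0%N.
  move=> /andP [oP aL'] hL'.
  have [C1 h1] := IH aL' (fun o' h => hL' o' (@mem_behead _ (o :: L') _ h)).
  have [C2 h2] := place_estimate c smon K0 oP (hL' o (mem_head _ _)).
  exists (maxn C1 C2) => o'; rewrite inE => /orP [/eqP ->|/h1 h].
    by apply: estS h2; apply: leq_maxr.
  by apply: estS h; apply: leq_maxl.
(* The height of x exceeds [C0] for the non-vanishing, C + 1 for the final contradiction, and 1 so
   that logarithms to its base make sense. All these constants were fixed before q. *)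
have [x Ex hx] := E1inf (maxn C0 (maxn C.+1 1)).
move: hx; rewrite !gtn_max => /and3P [hxC0 hxC hx1].
have [y Ey hy] := E1inf (height x ^ 144)%N.
set H1 := height x in hxC0 hxC hx1 hy; set H2 := height y in hy.
have H20 : (0 < H2)%N := height_gt0 y.
(* This q satisfies H1^(24 q) <= H2 <= H1^(24 q + 24), and 144 = 24 * 6 ensures q >= 6. *)
pose e := trunc_log H1 H2; pose q := (e %/ 24)%N.
have /andP [e1 e2] : (H1 ^ e <= H2 < H1 ^ e.+1)%N by apply: trunc_log_bounds.
have e144 : (144 <= e)%N by apply: trunc_log_max => //; apply: ltnW.
have q6 : (5 < q)%N by rewrite /q; apply: (@leq_div2r 24) e144.
have eq24 := divn_eq e 24; have em24 : (e %% 24 < 24)%N by rewrite ltn_mod.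
rewrite -/q in eq24.
have H12 : (H1 ^ (24 * q) <= H2)%N.
  by apply: leq_trans e1; rewrite leq_exp2l //; lia.
have H21 : (H2 <= H1 ^ (24 * q + 24))%N.
  by apply: leq_trans (ltnW e2) _; rewrite leq_exp2l //; lia.
have q0 : (0 < q)%N by apply: ltn_trans q6.
have [U [V UV]] := hc q q0.
have [j jq nz] := hC0 q U V x y q0 UV hxC0.
set Pv := aux_val s U V q j x y.
have Pv0 : Pv != 0 by rewrite /Pv /aux_val !mulf_neq0 ?expf_neq0 ?denqQ_neq0.
have [C' _ hint] := aux_val_int s c.
have [z hz _] := hint q U V j x y q0 UV.
have z0 : z != 0 by apply: contraNneq Pv0 => h; rewrite /Pv hz h.
have g1 : 1 <= \prod_(o <- L) placev o Pv.
  by rewrite big_cons big_map /= /Pv hz prod_padic_ge1.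
have g2 : H1%:R ^+ (kap * (24 * q - j)) <=
    ((C ^ q)%:R ^+ l * (H1%:R ^+ (13 * q * D) * H2%:R) ^+ K : rat).
  have g3 : \prod_(o <- L) (placev o Pv ^+ K * H1%:R ^+ (k o * (24 * q - j))) <=
    \prod_(o <- L) ((C ^ q)%:R * arch_part o (H1%:R ^+ (13 * q * D) * H2%:R) ^+ K).
    rewrite !big_seq; apply: ler_prod => o oL; rewrite hC // andbT.
    by rewrite mulr_ge0 ?exprn_ge0 // (av_ge0 (absval_place (allP aL o oL))).
  have g4 : \prod_(o <- L) (H1%:R ^+ (k o * (24 * q - j))) = H1%:R ^+ (kap * (24 * q - j)) :> rat.
    rewrite /kap; elim: (L) => [|o L' IH]; first by rewrite !big_nil expr0.
    by rewrite !big_cons IH -exprD mulnDl.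
  have g5 : \prod_(o <- L) arch_part o (H1%:R ^+ (13 * q * D) * H2%:R) = H1%:R ^+ (13 * q * D) * H2%:R.
    by rewrite big_cons big_map /= big1 ?mulr1.
  rewrite !big_split /= g4 !prodrXl g5 big_const_seq count_predT iter_mulr_1 in g3.
  by apply: le_trans g3; rewrite ler_peMl ?exprn_ge0 ?ler0n // exprn_ege1.
have g6 : (H1 ^ (kap * (24 * q - j)) <= (C ^ q) ^ l * (H1 ^ (13 * q * D) * H2) ^ K)%N.
  by move: g2; rewrite -!natrX -natrM -natrX -natrM ler_nat.
have g7 := thue_mahler_exponent D2 q6 (erefl K) jq hkap.
(* Cancelling the common power leaves H1^(q K) <= (C + 1)^(q K), against the choice of x. *)
have g8 : (H1 ^ ((13 * q * D + (24 * q + 24)) * K + q * K) <= C.+1 ^ (q * K) * H1 ^ ((13 * q * D + (24 * q + 24)) * K))%N.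
  apply: (@leq_trans (H1 ^ (kap * (24 * q - j)))); first by rewrite leq_exp2l.
  apply: leq_trans g6 _; apply: leq_mul.
    rewrite -expnM; apply: (@leq_trans (C.+1 ^ (q * l))); first exact: leq_wexp2r.
    by rewrite leq_pexp2l // leq_mul2l /K leq_pmull ?orbT.
  by rewrite [leqRHS]expnM leq_wexp2r // expnD leq_mul.
move: g8; rewrite addnC expnD leq_pmul2r ?expn_gt0 ?(ltnW hx1) //.
by rewrite leq_exp2r ?muln_gt0 ?q0 // leqNgt hxC.
Qed.

(** * From monic polynomials to arbitrary binary forms *)

Lemma northcott N : exists L : seq rat, forall x, (height x <= N)%N -> x \in L.
Proof.
exists [seq (a%:Z - N%:Z)%:~R / b%:R | a <- iota 0 (2 * N).+1, b <- iota 0 N.+1] => x.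
rewrite /height geq_max => /andP [h1 h2].
apply/allpairsP; exists (absz (numq x + N%:Z), absz (denq x)); split.
- by rewrite mem_iota add0n /=; lia.
- by rewrite mem_iota add0n.
- rewrite /= -denq_absz -[LHS]divq_num_den; congr (_%:~R / _).
  by lia.
Qed.

(* If l is the leading coefficient of p, this is l^(D-1) p(X / l), with D = deg p. *)
Definition monicize (p : {poly int}) : {poly int} :=
  \poly_(i < size p) (if i == (size p).-1 then 1
                      else p`_i * lead_coef p ^+ ((size p).-2 - i)).

Section Monicize.
Variables (p : {poly int}) (p1 : (1 < size p)%N).
Local Notation l := (lead_coef p).
Let hs : size p = (size p).-1.+1. Proof. by case: (size p) p1. Qed.
Let l0 : l%:~R != 0 :> rat.
Proof. by rewrite intr_eq0 lead_coef_eq0 -size_poly_eq0 hs. Qed.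

Lemma size_monicize : size (monicize p) = size p.
Proof. by rewrite size_poly_eq // eqxx oner_neq0. Qed.

Lemma monicize_monic : monicize p \is monic.
Proof.
rewrite monicE lead_coefE size_monicize coef_poly {2}hs ltnSn eqxx //.
Qed.

Lemma monicizeE : pZtoQ (monicize p) =
  l%:~R ^+ (size p).-2 *: (pZtoQ p \Po (l%:~R^-1 *: 'X)).
Proof.
apply/polyP => i; rewrite coef_map coefZ comp_polyE coef_sum size_rat_int_poly.
rewrite coef_poly; case: ltnP => hi; last first.
  rewrite big1 ?mulr0 // => j _; rewrite exprZn !coefZ coefXn.
  by rewrite (gtn_eqF (leq_trans (ltn_ord j) hi)) !mulr0.
rewrite (bigD1 (Ordinal hi)) //= big1 ?addr0; last first.
  move=> j /negPf ji; rewrite exprZn !coefZ coefXn.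
  by rewrite eq_sym -val_eqE /= in ji *; rewrite ji !mulr0.
rewrite exprZn !coefZ coefXn eqxx mulr1 coef_map /=.
have hD : (size p).-1 = (size p).-2.+1 by rewrite [in LHS]hs /=; case: (size p) p1 => [|[]].
case: eqP => [->|/eqP ni].
  rewrite -lead_coefE hD exprVn exprS.
  by field; rewrite l0 expf_neq0.
have ile : (i <= (size p).-2)%N.
  have : (i < (size p).-1)%N by rewrite ltn_neqAle ni -ltnS -hs.
  by rewrite {1}hD.
rewrite rmorphM rmorphXn /= -{2}(subnK ile) exprD mulrCA exprVn; congr (_ * _).
by rewrite mulfK // expf_neq0.
Qed.

Lemma separable_monicize : separable_poly (pZtoQ p) -> separable_poly (pZtoQ (monicize p)).
Proof.
rewrite separable_poly.unlock monicizeE => sp.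
rewrite derivZ deriv_comp derivZ derivX alg_polyC mulrC mul_polyC.
rewrite coprimepZl ?expf_neq0 // coprimepZr ?expf_neq0 // coprimepZr ?invr_eq0 //.
exact: coprimep_comp_poly.
Qed.

Lemma horner_monicize x : (pZtoQ (monicize p)).[l%:~R * x] = l%:~R ^+ (size p).-2 * (pZtoQ p).[x].
Proof.
by rewrite monicizeE hornerZ horner_comp hornerZ hornerX mulKf.
Qed.

End Monicize.

Lemma denq_mul_int (l : int) (x : rat) : exists g : int, denq x = g * denq (l%:~R * x).
Proof.
set y := l%:~R * x.
have e : numq y * denq x = l * numq x * denq y.
  apply/eqP; rewrite -(eqr_int rat) !rmorphM /= !numqE /y; apply/eqP; ring.
have /dvdzP [g hg] : (denq y %| denq x)%Z.
  rewrite dvdzE -(Gauss_dvdr _ (_ : coprime `|denq y| `|numq y|)); last first.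
    by rewrite coprime_sym coprime_num_den.
  by rewrite -abszM e abszM dvdn_mull.
by exists g.
Qed.

(** An integral multiple p of s divides h over Z, so the form of p at x divides that of h. With l
    the leading coefficient of p, the form of [monicize p] at l x divides a power of l times the
    form of p at x. Hence the monic case applies to l x with |l| M in place of M. *)
Lemma thue_mahler (h : {poly int}) (s : {poly rat}) (D M : nat) :
  (size h <= D.+1)%N -> (0 < M)%N -> separable_poly s -> (3 < size s)%N -> s %| pZtoQ h ->
  exists L : seq rat, forall x,
    (denq x)%:~R ^+ D * (pZtoQ h).[x] != 0 ->
    has_primes_in M ((denq x)%:~R ^+ D * (pZtoQ h).[x]) -> x \in L.
Proof.
move=> sh M0 ss s3 /dvdpP_rat_int [p [a a0 sE] [r hE]].
have sp : size p = size s by rewrite sE size_scale // size_rat_int_poly.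
have p3 : (3 < size p)%N by rewrite sp.
have p1 : (1 < size p)%N by apply: ltn_trans p3.
have psep : separable_poly (pZtoQ p).
  by apply: dvdp_separable ss; rewrite sE dvdpZr.
set l := lead_coef p; set d := (size p).-1.
have l0 : l != 0 by rewrite lead_coef_eq0 -size_poly_eq0; case: (size p) p1.
have lQ : l%:~R != 0 :> rat by rewrite intr_eq0.
have lM0 : (0 < `|l| * M)%N by rewrite muln_gt0 absz_gt0 l0.
have [N hN] := thue_mahler_monic (monicize_monic p1)
  (eq_ind_r (fun n => (3 < n)%N) p3 (size_monicize p)) (separable_monicize p1 psep) lM0.
have [L hL] := northcott N.
exists [seq y / l%:~R | y <- L] => x hx0 hx.
apply/mapP; exists (l%:~R * x); last by rewrite mulrAC mulfV // mul1r.
apply/hL/hN.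
  rewrite /form_val horner_monicize // mulf_neq0 ?expf_neq0 ?denqQ_neq0 // mulf_neq0 ?expf_neq0 //.
  by apply: contraNneq hx0; rewrite hE rmorphM hornerM => ->; rewrite mul0r mulr0.
move=> q z hz qp qz.
have hd : (size p <= d.+1)%N by exact: leqSpred.
have [dD sr] : (d <= D)%N /\ (size r <= (D - d).+1)%N.
  have h0 : h != 0 by apply: contraNneq hx0 => ->; rewrite rmorph0 horner0 mulr0.
  have r0 : r != 0 by apply: contraNneq h0 => r0; rewrite hE r0 mulr0.
  have p0 : p != 0 by rewrite -size_poly_eq0; case: (size p) p1.
  have := sh; rewrite hE size_mul // => sh'; rewrite -size_poly_eq0 in r0.
  by move: r0 p1 sh'; rewrite /d; move: (size p) (size r); clear; lia.
have [B hB] := polyint_bounded p; have [B' hB'] := polyint_bounded r.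
have [z1 hz1 _] := hom_int x hd hB; have [z2 hz2 _] := hom_int x sr hB'.
have [g hg] := denq_mul_int l x.
have ez : z * g ^+ d = l ^+ (size p).-2 * z1.
  apply/eqP; rewrite -(eqr_int rat) !rmorphM !rmorphXn /= -hz -hz1 /form_val.
  by rewrite size_monicize // -/d horner_monicize // hg rmorphM exprMn; apply/eqP; ring.
have : (q %| `|(l ^+ (size p).-2 * z1)%R|)%N by rewrite -ez abszM dvdn_mulr.
rewrite abszM Euclid_dvdM // abszX => /orP [|qz1].
  by rewrite Euclid_dvdX // => /andP [ql _]; rewrite dvdn_mulr.
apply: dvdn_mull; apply: (hx q (z1 * z2)) => //; last by rewrite abszM dvdn_mulr.
by rewrite rmorphM /= -hz1 -hz2 hE rmorphM hornerM -{1}(subnKC dD) exprD; ring.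
Qed.

(** * Homogeneous iteration *)

(* The homogenization of p in degree n; a pair (a, b) stands for the point a / b of the
   projective line, (1, 0) for infinity. *)
Definition hev (R : comNzRingType) (n : nat) (p : {poly int}) (u : R * R) : R :=
  \sum_(i < n.+1) (p`_i)%:~R * u.1 ^+ i * u.2 ^+ (n - i).

Definition pscale (R : comNzRingType) (t : R) (u : R * R) : R * R := (t * u.1, t * u.2).

Definition pmap (R S : comNzRingType) (phi : R -> S) (u : R * R) : S * S := (phi u.1, phi u.2).

Section Hev.
Variable R : comNzRingType.
Implicit Types (u : R * R) (t : R) (p : {poly int}).

Lemma hev_morph (S : comNzRingType) (phi : {rmorphism R -> S}) n p u :
  phi (hev n p u) = hev n p (pmap phi u).
Proof.
rewrite rmorph_sum; apply: eq_bigr => i _.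
by rewrite !rmorphM !rmorphXn rmorph_int.
Qed.

Lemma hev_scale n p t u : hev n p (pscale t u) = t ^+ n * hev n p u.
Proof.
rewrite mulr_sumr; apply: eq_bigr => i _; rewrite /= !exprMn.
have ni : (i <= n)%N by rewrite -ltnS.
have -> : t ^+ n = t ^+ i * t ^+ (n - i) by rewrite -exprD subnKC.
by ring.
Qed.

Lemma hev_horner n p (x : R) : (size p <= n.+1)%N -> hev n p (x, 1) = (map_poly intr p).[x].
Proof.
move=> sp; rewrite (@horner_coef_wide _ n.+1); last first.
  by apply: leq_trans sp; apply: size_poly.
by apply: eq_bigr => i _; rewrite /= expr1n mulr1 coef_map.
Qed.

Lemma hev_MXn n e p u : (e <= n)%N -> (size p <= (n - e).+1)%N ->
  hev n (p * 'X^e) u = u.1 ^+ e * hev (n - e) p u.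
Proof.
move=> en sp; rewrite /hev mulr_sumr -(big_mkord xpredT (fun i => ((p * 'X^e)`_i)%:~R * u.1 ^+ i * u.2 ^+ (n - i))).
rewrite (@big_cat_nat _ _ _ e) //=; last exact: leqW.
rewrite big_nat big1 ?add0r => [|i /andP [_ ie]]; last by rewrite coefMXn ie !mul0r.
rewrite -{1}[e]add0n big_addn subSn // big_mkord; apply: eq_bigr => i _.
rewrite coefMXn ltnNge leq_addl /= addnK exprD subnDA subnAC.
by rewrite -subnDA addnC subnDA; ring.
Qed.

Lemma hev_snd0 n p u : u.2 = 0 -> hev n p u = (p`_n)%:~R * u.1 ^+ n.
Proof.
move=> u0; rewrite /hev big_ord_recr /= subnn expr0 mulr1 u0 big1 ?add0r // => i _.
by rewrite expr0n subn_eq0 leqNgt ltn_ord mulr0.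
Qed.

Lemma hev_fst0 n p u : u.1 = 0 -> hev n p u = (p`_0)%:~R * u.2 ^+ n.
Proof.
move=> u0; rewrite /hev big_ord_recl /= subn0 u0 expr0 mulr1 big1 ?addr0 // => i _.
by rewrite exprS mul0r mulr0 mul0r.
Qed.

Variables (d : nat) (F G : {poly int}).

Definition hmap u : R * R := (hev d F u, hev d G u).

Lemma hmap_scale t u : hmap (pscale t u) = pscale (t ^+ d) (hmap u).
Proof. by rewrite /hmap !hev_scale. Qed.

Lemma iter_hmap_scale k t u : iter k hmap (pscale t u) = pscale (t ^+ (d ^ k)) (iter k hmap u).
Proof.
elim: k => [|k IH] /=; first by rewrite expn0 expr1.
by rewrite IH hmap_scale -exprM expnSr.
Qed.

End Hev.

Lemma iter_hmap_morph (R S : comNzRingType) (phi : {rmorphism R -> S}) d F G k (u : R * R) :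
  pmap phi (iter k (hmap d F G) u) = iter k (hmap d F G) (pmap phi u).
Proof. by elim: k => [|k IH] //=; rewrite -IH /hmap /pmap /= !hev_morph. Qed.

(* The pullback by the k-th iterate of F/G of the homogenization of p in degree n. *)
Definition form (R : comNzRingType) (d n : nat) (F G p : {poly int}) (k : nat) (u : R * R) : R :=
  hev n p (iter k (hmap d F G) u).

Lemma form_scale (R : comNzRingType) d n F G p k (t : R) u :
  form d n F G p k (pscale t u) = t ^+ (n * d ^ k) * form d n F G p k u.
Proof. by rewrite /form iter_hmap_scale hev_scale -exprM mulnC. Qed.

Lemma form_morph (R S : comNzRingType) (phi : {rmorphism R -> S}) d n F G p k (u : R * R) :
  phi (form d n F G p k u) = form d n F G p k (pmap phi u).
Proof. by rewrite /form hev_morph iter_hmap_morph. Qed.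

(** Evaluating the form at the generic point of the affine line makes [form_morph] yield its values
    in every ring. *)
Definition form_poly (d n : nat) (F G p : {poly int}) (k : nat) : {poly int} :=
  form d n F G p k ('X, 1).

Lemma size_hev (n w : nat) (p : {poly int}) (u : {poly int} * {poly int}) :
  (size u.1 <= w.+1)%N -> (size u.2 <= w.+1)%N -> (size (hev n p u) <= (n * w).+1)%N.
Proof.
move=> s1 s2; apply: (leq_trans (size_sum _ _ _)); apply/bigmax_leqP => i _.
have sX (q : {poly int}) m : (size q <= w.+1)%N -> (size (q ^+ m) <= (w * m).+1)%N.
  move=> sq; apply: leq_trans (size_poly_exp_leq _ _) _; rewrite ltnS leq_mul2r.
  by apply/orP; right; case: (size q) sq.
have -> : (p`_i)%:~R = (p`_i)%:P :> {poly int} by rewrite -[in RHS](intz p`_i) rmorph_int.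
rewrite -mulrA mul_polyC; apply: leq_trans (size_scale_leq _ _) _.
apply: leq_trans (size_polyMleq _ _) _.
have h1 := sX _ i s1; have h2 := sX _ (n - i)%N s2.
have ni : (i <= n)%N by rewrite -ltnS.
have e : (n * w = w * i + w * (n - i))%N by rewrite -mulnDr subnKC // mulnC.
rewrite e; move: h1 h2; move: (size (u.1 ^+ i)) (size (u.2 ^+ _)) (w * i)%N (w * _)%N.
by clear; lia.
Qed.

Lemma size_form_poly d n F G p k :
  (size (form_poly d n F G p k) <= (n * d ^ k).+1)%N.
Proof.
have h : (size (iter k (hmap d F G) ('X, 1 : {poly int})%R).1 <= (d ^ k).+1)%N /\
         (size (iter k (hmap d F G) ('X, 1 : {poly int})%R).2 <= (d ^ k).+1)%N.
  elim: k => [|k [IH1 IH2]] /=; first by rewrite size_polyX size_poly1.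
  by rewrite expnS !size_hev.
by rewrite /form_poly /form size_hev; case: h.
Qed.

Lemma form_polyE (R : comNzRingType) d n F G p k (x : R) :
  (map_poly intr (form_poly d n F G p k)).[x] = form d n F G p k (x, 1).
Proof.
have cx : commr_rmorph (intr : int -> R) x by move=> a; apply: mulrC.
rewrite -[LHS]/(horner_morph cx (form_poly d n F G p k)) form_morph /pmap /=.
by rewrite horner_morphX rmorph1.
Qed.

Lemma map_ZtoQ_ratr (K : numFieldType) (p : {poly int}) :
  map_poly (ratr : rat -> K) (pZtoQ p) = map_poly intr p.
Proof. by apply/polyP => i; rewrite !coef_map /= ratr_int. Qed.

(** * Preimages of zero *)

Section Preimages.
Variables (d e : nat) (F G P : {poly int}).
Hypotheses (d2 : (1 < d)%N) (e0 : (0 < e)%N) (ed : (e < d)%N).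
Hypotheses (FE : F = P * 'X^e) (P0 : P`_0 != 0).
Hypotheses (sF : (size F <= d.+1)%N) (sG : (size G <= d.+1)%N).
Hypotheses (FGd : (F`_d != 0) || (G`_d != 0)).
Hypothesis cFG : coprimep (pZtoQ F) (pZtoQ G).

Lemma size_cofactor : (size P <= (d - e).+1)%N.
Proof.
have Pn0 : P != 0 by apply: contraNneq P0 => ->; rewrite coef0.
have := sF; rewrite FE size_Mmonic ?monicXn // size_polyXn.
by move: ed; move: (size P); clear; lia.
Qed.

Section InField.
Variable K : numClosedFieldType.
Implicit Types (u : K * K) (z w : K).
Local Notation phi := (@hmap K d F G).
Local Notation fm k := (@form K d (d - e) F G P k).
Local Notation FK := (map_poly (intr : int -> K) F).
Local Notation GK := (map_poly (intr : int -> K) G).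

Let intK0 (z : int) : ((z%:~R : K) == 0) = (z == 0). Proof. exact: intr_eq0. Qed.

Lemma no_common_root z : FK.[z] = 0 -> GK.[z] = 0 -> False.
Proof.
move=> Fz Gz; have : coprimep FK GK by rewrite -(map_ZtoQ_ratr K F) -(map_ZtoQ_ratr K G) coprimep_map.
by move/coprimep_root => /(_ z); rewrite rootE Fz eqxx Gz eqxx => /(_ isT).
Qed.

Lemma pair_scale u : u.2 != 0 -> u = pscale u.2 (u.1 / u.2, 1).
Proof. by case: u => a b /= b0; rewrite /pscale /= mulr1 mulrCA mulfV // mulr1. Qed.

(** F and G have no common zero on the projective line: [FGd] excludes infinity, coprimality the
    finite points. *)
Lemma hmap_eq0 u : phi u = (0, 0) -> u = (0, 0).
Proof.
move=> [h1 h2]; have [u20|u20] := eqVneq u.2 0.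
  move: h1 h2; rewrite !hev_snd0 // => /eqP h1 /eqP h2.
  suff u10 : u.1 = 0 by case: u u10 u20 {h1 h2} => a b /= -> ->.
  apply/eqP; apply: contraT => u10.
  move: h1 h2; rewrite !mulf_eq0 expf_eq0 (negPf u10) andbF !orbF !intK0.
  by case/orP: FGd => /negPf ->.
move: h1 h2; rewrite [u]pair_scale // !hev_scale !hev_horner // => /eqP h1 /eqP h2.
move: h1 h2; rewrite !mulf_eq0 expf_eq0 (negPf u20) andbF /= => /eqP h1 /eqP h2.
by case: (no_common_root h1 h2).
Qed.

Lemma iter_hmap_eq0 k u : iter k phi u = (0, 0) -> u = (0, 0).
Proof. by elim: k => [|k IH] //= /hmap_eq0. Qed.

Lemma hev_cofactor u : hev d F u = u.1 ^+ e * hev (d - e) P u.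
Proof. by rewrite FE hev_MXn ?size_cofactor // ltnW. Qed.

Lemma iter_hmap_fst0 k u : u.1 = 0 -> (iter k phi u).1 = 0.
Proof.
by move=> u0; elim: k => [|k IH] //=; rewrite hev_cofactor IH expr0n (gtn_eqF e0) mul0r.
Qed.

(* After i + 1 steps a zero of form i has reached the fixed point 0, which is not a
   zero of P. *)
Lemma form_disjoint i j u : (i < j)%N -> fm i u = 0 -> fm j u = 0 -> u = (0, 0).
Proof.
move=> ij hi hj; apply: (@iter_hmap_eq0 j).
have h1 : (iter j phi u).1 = 0.
  rewrite -(subnK ij) iterD; apply: iter_hmap_fst0 => /=.
  by rewrite hev_cofactor -[hev (d - e) P _]/(fm i u) hi mulr0.
move: hj; rewrite /form hev_fst0 // => /eqP; rewrite mulf_eq0 intK0 (negPf P0) /= expf_eq0.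
move=> /andP [_ /eqP h2]; case: (iter j phi u) h1 h2 => a b /= -> -> //.
Qed.

Lemma form_eventually u : u <> (0, 0) -> exists J, forall j, (J <= j)%N -> fm j u != 0.
Proof.
move=> u0; have [[i hi]|h] := classic (exists i, fm i u = 0); last first.
  by exists 0%N => j _; apply/eqP => hj; apply: h; exists j.
by exists i.+1 => j ij; apply/eqP => hj; apply: u0; apply: form_disjoint ij hi hj.
Qed.

Lemma forms_eventually (r : seq (K * K)) : (forall u, u \in r -> u <> (0, 0)) ->
  exists J, forall j u, (J <= j)%N -> u \in r -> fm j u != 0.
Proof.
elim: r => [|u r IH] hr; first by exists 0%N.
have [v vr|J1 h1] := IH; first by apply: hr; rewrite inE vr orbT.
have [J2 h2] := form_eventually (hr u (mem_head _ _)).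
exists (maxn J1 J2) => j v; rewrite geq_max inE => /andP [j1 j2] /orP [/eqP ->|vr].
  exact: h2.
exact: h1.
Qed.

(** The map is surjective on the projective line over an algebraically closed field, so a zero of P
    can be pulled back step by step. Infinity is the zero or the preimage when the polynomial to be
    solved has a vanishing top coefficient. *)
Lemma form_zero k : exists2 u, u <> (0, 0) & fm k u = 0.
Proof.
have hz (n : nat) (p : {poly K}) : (0 < n)%N -> (size p <= n.+1)%N -> p`_n != 0 -> exists z, root p z.
  move=> n0 sp pn; apply/closed_rootP; apply: contraNneq pn => s1.
  by rewrite nth_default // s1.
have surj u : u <> (0, 0) -> exists v t, [/\ v <> (0, 0), t != 0 & phi v = pscale t u].
  move=> u0.
  have [v v0 hv] : exists2 v, v <> (0, 0) & u.2 * hev d F v = u.1 * hev d G v.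
    pose p := u.2 *: FK - u.1 *: GK.
    have sp : (size p <= d.+1)%N.
      apply: leq_trans (size_polyD _ _) _; rewrite geq_max size_polyN.
      by rewrite !(leq_trans (size_scale_leq _ _)) // (leq_trans (size_poly _ _)).
    have [pd|pd] := eqVneq p`_d 0.
      exists (1, 0); first by move=> [/eqP]; rewrite oner_eq0.
      rewrite !hev_snd0 //= expr1n !mulr1; apply/eqP; rewrite -subr_eq0.
      by rewrite -pd /p coefB !coefZ !coef_map.
    have [z] := hz d p (ltnW d2) sp pd; rewrite rootE /p hornerD hornerN !hornerZ subr_eq0 => /eqP h.
    exists (z, 1); first by move=> [_ /eqP]; rewrite oner_eq0.
    by rewrite !hev_horner.
  have vn0 : phi v <> (0, 0) by move=> /hmap_eq0.
  exists v; have [u10|u10] := eqVneq u.1 0.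
    have u20 : u.2 != 0 by apply/eqP => u20; apply: u0; case: u u10 u20 {hv} => a b /= -> ->.
    have Fv : hev d F v = 0.
      by apply/eqP; move/eqP: hv; rewrite u10 mul0r mulf_eq0 (negPf u20).
    exists (hev d G v / u.2); split => //.
      rewrite mulf_neq0 ?invr_eq0 //; apply/eqP => Gv.
      by apply: vn0; rewrite /hmap Fv Gv.
    by rewrite /pscale /hmap Fv u10 mulr0 mulfVK.
  exists (hev d F v / u.1); split => //.
    rewrite mulf_neq0 ?invr_eq0 //; apply/eqP => Fv.
    apply: vn0; rewrite /hmap Fv; congr (_, _); apply/eqP; move/eqP: hv.
    by rewrite Fv mulr0 eq_sym mulf_eq0 (negPf u10).
  rewrite /pscale /hmap mulfVK //; congr (_, _).
  by apply: (mulfI u10); rewrite -hv; field.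
elim: k => [|k [u u0 hu]].
  have dn : (0 < d - e)%N by rewrite subn_gt0.
  have [Pd|Pd] := eqVneq P`_(d - e) 0.
    exists (1, 0); first by move=> [/eqP]; rewrite oner_eq0.
    by rewrite /form /= hev_snd0 //= Pd mul0r.
  have [||z hz'] := hz (d - e)%N (map_poly intr P) dn.
  - by apply: leq_trans (size_poly _ _) size_cofactor.
  - by rewrite coef_map intK0.
  exists (z, 1); first by move=> [_ /eqP]; rewrite oner_eq0.
  by rewrite /form /= hev_horner ?size_cofactor //; apply/eqP.
have [v [t [v0 t0 hv]]] := surj u u0; exists v => //.
rewrite /form iterSr hv -[LHS]/(fm k (pscale t u)) form_scale hu mulr0 //.
Qed.

(** Its zeros include the finite critical points. If it vanished identically, F and G would be
    multiples of one g; a root of g is a common root, and a constant g contradicts [FGd] since d >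
    0. *)
Lemma wronskianK_neq0 : GK * FK^`() - GK^`() * FK != 0.
Proof.
apply/eqP => W0; have FG0 : (GK != 0) || (FK != 0).
  rewrite orbC -negb_and; apply: contraTN FGd => /andP [/eqP f0 /eqP g0].
  by rewrite -!intK0 -!(coef_map (intr : int -> K)) f0 g0 !coef0 eqxx.
have [a [b [g [g0 Ga Fb _]]]] := wronskian_eq0 FG0 W0.
have [g1|g1] := eqVneq (size g) 1%N; last first.
  have [z] := closed_rootP g g1; rewrite rootE => /eqP gz.
  by apply: (@no_common_root z); rewrite ?Fb ?Ga hornerZ gz mulr0.
have c0 (p : {poly int}) c : map_poly (intr : int -> K) p = c *: g -> p`_d = 0.
  move=> pE; apply/eqP; rewrite -intK0 -(coef_map (intr : int -> K)) pE coefZ nth_default ?mulr0 //.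
  by rewrite g1; apply: ltnW.
by move: FGd; rewrite (c0 _ _ Fb) (c0 _ _ Ga) eqxx.
Qed.

Lemma hmap_finite z w : FK.[z] = w * GK.[z] -> phi (z, 1) = pscale GK.[z] (w, 1).
Proof. by move=> h; rewrite /hmap !hev_horner // h /pscale /= mulr1 mulrC. Qed.

Lemma formS j u : fm j.+1 u = fm j (phi u).
Proof. by rewrite /form iterSr. Qed.

(** The fibre over w is given by F - w G. Its degree is exactly d because infinity is not in the
    fibre, and a double root would be a zero of the Wronskian. *)
Lemma fiber_roots j w : fm j.+1 (1, 0) != 0 ->
  (forall z, root (GK * FK^`() - GK^`() * FK) z -> fm j.+1 (z, 1) != 0) ->
  fm j (w, 1) = 0 ->
  exists2 zs : seq K, uniq zs /\ size zs = d & forall z, z \in zs ->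
    [/\ GK.[z] != 0, FK.[z] = w * GK.[z] & fm j.+1 (z, 1) = 0].
Proof.
move=> hinf hcrit hw; pose q := FK - w *: GK.
have qd : q`_d != 0.
  apply: contraNneq hinf => qd; rewrite formS.
  have -> : phi (1, 0) = pscale (G`_d)%:~R (w, 1).
    rewrite /hmap !hev_snd0 //= /pscale /= expr1n !mulr1; congr (_, _).
    by apply/eqP; rewrite -subr_eq0 mulrC -qd /q coefB coefZ !coef_map.
  by rewrite form_scale hw mulr0.
have sq : size q = d.+1.
  apply/eqP; rewrite eqn_leq; apply/andP; split; last first.
    by rewrite ltnNge; apply: contra qd => h; rewrite nth_default.
  apply: leq_trans (size_polyD _ _) _; rewrite geq_max size_polyN.
  by rewrite (leq_trans (size_scale_leq _ _)) // (leq_trans (size_poly _ _)).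
have q0 : q != 0 by rewrite -size_poly_eq0 sq.
have qroot z : root q z -> [/\ GK.[z] != 0, FK.[z] = w * GK.[z] & fm j.+1 (z, 1) = 0].
  rewrite rootE /q hornerD hornerN hornerZ subr_eq0 => /eqP h; split => //.
    apply/eqP => Gz; apply: (@no_common_root z) => //.
    by rewrite h Gz mulr0.
  by rewrite formS (hmap_finite h) form_scale hw mulr0.
have qsep : separable_poly q.
  rewrite separable_poly.unlock; apply: Pdiv.ClosedField.root_coprimep => z qz.
  apply/negP => /eqP; rewrite /q derivB derivZ hornerD hornerN hornerZ => /eqP.
  rewrite subr_eq0 => /eqP q'z; have [Gz Fz fz] := qroot z qz.
  have : root (GK * FK^`() - GK^`() * FK) z.
    by rewrite rootE hornerD hornerN !hornerM Fz q'z; apply/eqP; ring.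
  by move/hcrit; rewrite fz eqxx.
have [zs qE] := closed_field_poly_normal q.
have lq : lead_coef q != 0 by rewrite lead_coef_eq0.
exists zs; last first.
  by move=> z zz; apply: qroot; rewrite qE rootZ // root_prod_XsubC.
split; first by rewrite -separable_prod_XsubC -(eqp_separable (eqp_scale _ lq)) -qE.
by apply/eqP; rewrite -eqSS -sq qE size_scale // size_prod_XsubC.
Qed.

(** From index J on, no form vanishes at infinity or at a zero of the Wronskian. A zero of form J
    thus has d >= 2 distinct preimages; two of these have disjoint fibres of d points each, which
    makes 2 d >= 4 zeros two levels up. *)
Lemma four_roots : exists k (zs : seq K), [/\ uniq zs, (3 < size zs)%N
  & forall z, z \in zs -> root (map_poly intr (form_poly d (d - e) F G P k)) z].
Proof.
have [rs WE] := closed_field_poly_normal (GK * FK^`() - GK^`() * FK).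
set W := _ - _ in WE; have W0 : W != 0 := wronskianK_neq0.
have lW : lead_coef W != 0 by rewrite lead_coef_eq0.
have [|J hJ] := @forms_eventually ((1, 0) :: [seq (z, 1) | z <- rs]).
  move=> u; rewrite inE => /orP [/eqP ->|/mapP [z _ ->]].
    by move=> [/eqP]; rewrite oner_eq0.
  by move=> [_ /eqP]; rewrite oner_eq0.
have hinf j : (J <= j)%N -> fm j (1, 0) != 0 by move=> jJ; apply: hJ => //; apply: mem_head.
have hcrit j z : (J <= j)%N -> root W z -> fm j (z, 1) != 0.
  move=> jJ; rewrite WE rootZ // root_prod_XsubC => zr; apply: hJ => //.
  by rewrite inE; apply/orP; right; apply/mapP; exists z.
have [[a b] u0 hu] := form_zero J.
have b0 : b != 0.
  apply/eqP => b0; have := hinf J (leqnn J); have a0 : a != 0.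
    by apply/eqP => a0; apply: u0; rewrite a0 b0.
  have : fm J (pscale a (1, 0)) = 0 by rewrite /pscale /= mulr1 mulr0 -[X in (a, X)]b0.
  by rewrite form_scale => /eqP; rewrite mulf_eq0 expf_eq0 (negPf a0) andbF /= => ->.
have hw : fm J (a / b, 1) = 0.
  move: hu; rewrite [(a, b)]pair_scale //= form_scale => /eqP.
  by rewrite mulf_eq0 expf_eq0 (negPf b0) andbF => /eqP.
have hc j : (J <= j)%N -> forall z, root W z -> fm j.+1 (z, 1) != 0.
  by move=> jJ z; apply: hcrit; apply: leqW.
have [zs [uzs szs] hzs] := fiber_roots (hinf J.+1 (leqnSn J)) (hc J (leqnn J)) hw.
have [w1 [w2 [w1z w2z w12]]] : exists w1 w2, [/\ w1 \in zs, w2 \in zs & w1 != w2].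
  case: zs uzs szs {hzs} => [|w1 [|w2 zs]] /=.
  - by move=> _ h; move: d2; rewrite -h.
  - by move=> _ h; move: d2; rewrite -h.
  - move=> /andP []; rewrite inE negb_or => /andP [h _] _ _; exists w1, w2.
    by rewrite !inE !eqxx orbT.
have [_ _ f1] := hzs _ w1z; have [_ _ f2] := hzs _ w2z.
have [z1 [u1 s1] h1] := fiber_roots (hinf J.+2 (leqW (leqnSn J))) (hc J.+1 (leqnSn J)) f1.
have [z2 [u2 s2] h2] := fiber_roots (hinf J.+2 (leqW (leqnSn J))) (hc J.+1 (leqnSn J)) f2.
exists J.+2, (z1 ++ z2); split.
- rewrite cat_uniq u1 u2 andbT /=; apply/hasPn => z /h2 [Gz Fz _].
  apply/negP => /h1 [_ Fz' _]; move: w12; rewrite -(inj_eq (mulIf Gz)) -Fz -Fz' eqxx //.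
- by rewrite size_cat s1 s2; move: d2; clear; lia.
- move=> z; rewrite mem_cat => /orP [/h1|/h2] [_ _ h]; by rewrite rootE form_polyE h.
Qed.

(** It does not vanish at 0: the point 0 is fixed by the map and P(0) is not 0. *)
Lemma form_poly_neq0 k : form_poly d (d - e) F G P k != 0.
Proof.
apply/eqP => h; have := form_polyE d (d - e) F G P k (0 : K).
rewrite h rmorph0 horner0 => /esym h0; have h1 := @iter_hmap_fst0 k (0, 1) erefl.
move: h0; rewrite /form hev_fst0 // => /eqP; rewrite mulf_eq0 intK0 (negPf P0) /= expf_eq0.
move=> /andP [_ /eqP h2]; have : iter k phi (0, 1) = (0, 0).
  by case: (iter k phi (0, 1)) h1 h2 => a b /= -> ->.
by move/iter_hmap_eq0 => [/eqP]; rewrite oner_eq0.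
Qed.

End InField.

Local Notation toC := (map_poly (ratr : rat -> algC)).

(** If z were not a root of the quotient, its full multiplicity in h would pass to the gcd and so to
    h', where the multiplicity is one less. *)
Lemma squarefree_part_root (h : {poly rat}) (z : algC) : h != 0 ->
  root (toC h) z -> root (toC (h %/ gcdp h h^`())) z.
Proof.
move=> h0 hz; set t := gcdp h h^`(); set s := h %/ t.
have hst : h = s * t by rewrite divpK // dvdp_gcdl.
have mh0 : toC h != 0 by rewrite map_poly_eq0.
apply: contraLR hz => sz; apply/negP => hz.
have [n [q qz hq]] := multiplicity_XsubC (toC h) z; rewrite mh0 /= in qz.
case: n hq => [|n] hq.
  have : root (q * ('X - z%:P) ^+ 0) z by rewrite -hq.
  by rewrite expr0 mulr1 (negPf qz).
have dt : ('X - z%:P) ^+ n.+1 %| toC t.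
  have : ('X - z%:P) ^+ n.+1 %| toC s * toC t.
    have -> : toC s * toC t = q * ('X - z%:P) ^+ n.+1 by rewrite -hq [in RHS]hst rmorphM.
    by rewrite dvdp_mull.
  by rewrite Gauss_dvdpr // coprimep_expl // coprimep_sym coprimep_XsubC.
have dh' : ('X - z%:P) ^+ n.+1 %| (toC h)^`().
  by rewrite deriv_map (dvdp_trans dt) // dvdp_map dvdp_gcdr.
move: dh'; rewrite hq derivM deriv_exp derivXsubC mul1r /=.
rewrite dvdp_addr; last exact: dvdp_mull.
rewrite mulrnAr -mulrnAl exprS dvdp_mul2r; last first.
  by rewrite expf_neq0 ?polyXsubC_eq0.
rewrite dvdp_XsubCl rootE hornerMn mulrn_eq0 /= -rootE.
by apply/negP.
Qed.

Lemma form_poly_separable_factor : exists k (s : {poly rat}),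
  [/\ separable_poly s, (3 < size s)%N & s %| pZtoQ (form_poly d (d - e) F G P k)].
Proof.
have [k [zs [uzs szs hzs]]] := four_roots algC.
pose h := pZtoQ (form_poly d (d - e) F G P k); exists k, (h %/ gcdp h h^`()).
have h0 : h != 0.
  by rewrite -size_poly_eq0 size_rat_int_poly size_poly_eq0 (form_poly_neq0 algC).
have ss := make_separable h0; split => //; last first.
  by rewrite -[X in _ %| X](divpK (dvdp_gcdl h h^`())) dvdp_mulr.
apply: leq_trans szs _; rewrite -(size_map_poly (ratr : rat -> algC)); apply: ltnW.
apply: max_poly_roots => //; first by rewrite map_poly_eq0 separable_poly_neq0.
apply/allP => z /hzs hz; apply: squarefree_part_root => //.
by rewrite map_ZtoQ_ratr.
Qed.

End Preimages.

(** * Orbits of rational points *)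

Definition lowest (x : rat) : int * int := (numq x, denq x).

Lemma hev_lowest n (p : {poly int}) x : (size p <= n.+1)%N ->
  (hev n p (lowest x))%:~R = (denq x)%:~R ^+ n * (pZtoQ p).[x] :> rat.
Proof.
move=> sp; rewrite hev_morph -(@hev_horner _ n) // -hev_scale /pscale /pmap /= mulr1.
by rewrite numqE mulrC.
Qed.

Lemma form_lowest d n F G p k x :
  (form d n F G p k (lowest x))%:~R =
  (denq x)%:~R ^+ (n * d ^ k) * (pZtoQ (form_poly d n F G p k)).[x] :> rat.
Proof.
rewrite form_morph form_polyE -form_scale /pscale /pmap /= mulr1.
by rewrite numqE mulrC.
Qed.

Lemma lowest_fraction (a b : int) x : b != 0 -> x = a%:~R / b%:~R ->
  exists t, (a, b) = pscale t (lowest x).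
Proof.
move=> b0 xE; have bQ : b%:~R != 0 :> rat by rewrite intr_eq0.
have e : numq x * b = a * denq x.
  by apply/eqP; rewrite -(eqr_int rat) !rmorphM /= numqE xE mulrAC mulfVK.
have /dvdzP [t ht] : (denq x %| b)%Z.
  rewrite dvdzE -(Gauss_dvdr _ (_ : coprime `|denq x| `|numq x|)); last first.
    by rewrite coprime_sym coprime_num_den.
  by rewrite -abszM e abszM dvdn_mull.
exists t; rewrite /pscale /= -ht; congr (_, _).
by apply: (mulIf (denq_neq0 x)); rewrite -e ht; ring.
Qed.

Lemma hev_mod2 n (p : {poly int}) (u : int * int) (q : int) :
  (q %| u.2)%Z -> (q %| hev n p u)%Z -> (q %| p`_n * u.1 ^+ n)%Z.
Proof.
move=> q2; rewrite /hev big_ord_recr /= rpredDl.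
  by rewrite subnn expr0 mulr1 intz.
apply: rpred_sum => i _; rewrite dvdz_mull //.
have : (0 < n - i)%N by rewrite subn_gt0.
by case: (n - i)%N => // k _; rewrite exprS dvdz_mulr.
Qed.

Lemma hev_mod1 n (p : {poly int}) (u : int * int) (q : int) :
  (q %| u.1)%Z -> (q %| hev n p u)%Z -> (q %| p`_0 * u.2 ^+ n)%Z.
Proof.
move=> q1; rewrite /hev big_ord_recl /= rpredDr.
  by rewrite subn0 expr0 mulr1 intz.
by apply: rpred_sum => i _; rewrite dvdz_mulr // dvdz_mull // exprS dvdz_mulr.
Qed.

Lemma prime_dvdzM p (a b : int) : prime p ->
  (p%:Z %| a * b)%Z -> (p%:Z %| a)%Z \/ (p%:Z %| b)%Z.
Proof.
move=> pp; rewrite !dvdzE abszM /= Euclid_dvdM // => /orP [h|h]; [left|right]; exact: h.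
Qed.

Lemma prime_dvdzX p (a : int) n : prime p -> (p%:Z %| a ^+ n)%Z -> (p%:Z %| a)%Z.
Proof. by move=> pp; rewrite !dvdzE abszX /= Euclid_dvdX // => /andP []. Qed.

Lemma prime_lowest p x : prime p -> (p%:Z %| numq x)%Z -> (p%:Z %| denq x)%Z -> False.
Proof.
move=> pp; rewrite !dvdzE /= => h1 h2.
have : (p %| gcdn `|numq x| `|denq x|)%N by rewrite dvdn_gcd h1.
by rewrite (eqP (coprime_num_den x)) Euclid_dvd1.
Qed.

Lemma int_bezout (F G : {poly int}) : coprimep (pZtoQ F) (pZtoQ G) ->
  exists (u v : {poly int}) (c : int), c != 0 /\ u * F + v * G = c%:P.
Proof.
move/Bezout_eq1_coprimepP => [[u' v'] /=].
have [u [a a0 ->]] := rat_poly_scale u'; have [v [b b0 ->]] := rat_poly_scale v'.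
move=> h; exists (b *: u), (a *: v), (a * b); split; first by rewrite mulf_neq0.
have aQ : a%:~R != 0 :> rat by rewrite intr_eq0.
have bQ : b%:~R != 0 :> rat by rewrite intr_eq0.
apply: (map_inj_poly (f := intr : int -> rat)) => //; first exact: intr_inj.
rewrite rmorphD !rmorphM /= !map_polyZ !map_polyC /=.
rewrite -[RHS]mulr1 -h mulrDr -!mul_polyC.
have pa : (a%:~R)%:P * (a%:~R^-1)%:P = 1 :> {poly rat} by rewrite -polyCM mulfV.
have pb : (b%:~R)%:P * (b%:~R^-1)%:P = 1 :> {poly rat} by rewrite -polyCM mulfV.
have e1 : forall (A A' B U f : {poly rat}), A * A' = 1 -> A * B * (A' * U * f) = B * U * f.
  by move=> A A' B' U f' h1; rewrite -[RHS]mul1r -h1; ring.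
by rewrite e1 //; congr (_ + _); rewrite [X in _ = X * _]mulrC e1.
Qed.

Section Orbit.
Variables (d e : nat) (F G P : {poly int}).
Hypotheses (d2 : (1 < d)%N) (e0 : (0 < e)%N) (ed : (e < d)%N).
Hypotheses (FE : F = P * 'X^e) (P0 : P`_0 != 0).
Hypotheses (sF : (size F <= d.+1)%N) (sG : (size G <= d.+1)%N).
Hypotheses (FGd : (F`_d != 0) || (G`_d != 0)).
Hypothesis cFG : coprimep (pZtoQ F) (pZtoQ G).

(** These are primes of bad reduction. If p does not divide the denominator B, homogenizing u F + v
    G = c makes p divide c B^(N + d), hence c; if p divides B, it divides a top coefficient of F or
    G that is not 0. *)
Lemma common_primes : exists2 M : nat, (0 < M)%N & forall p x, prime p ->
  (p%:Z %| hev d F (lowest x))%Z -> (p%:Z %| hev d G (lowest x))%Z -> (p %| M)%N.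
Proof.
have [u [v [c [c0 uv]]]] := int_bezout cFG.
pose m : int := if F`_d == 0 then G`_d else F`_d.
have m0 : m != 0 by rewrite /m; case: (boolP (F`_d == 0)) FGd.
exists `|(c * m)%R|%N; first by rewrite absz_gt0 mulf_neq0.
move=> p x pp pF pG; rewrite -[p]/(absz p%:Z) -dvdzE.
have [pB|pB] := boolP (p%:Z %| denq x)%Z.
  have pA : ~ (p%:Z %| numq x)%Z by move=> pA; apply: prime_lowest pp pA pB.
  apply: dvdz_mull; rewrite /m; case: ifP => _.
    by case: (prime_dvdzM pp (hev_mod2 pB pG)) => // /(prime_dvdzX pp).
  by case: (prime_dvdzM pp (hev_mod2 pB pF)) => // /(prime_dvdzX pp).
apply: dvdz_mulr; pose N := maxn (size u) (size v).
have su : (size u <= N.+1)%N by apply: leqW; apply: leq_maxl.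
have sv : (size v <= N.+1)%N by apply: leqW; apply: leq_maxr.
have eq : hev N u (lowest x) * hev d F (lowest x) + hev N v (lowest x) * hev d G (lowest x)
    = c * denq x ^+ (N + d).
  apply/eqP; rewrite -(eqr_int rat) rmorphD !rmorphM rmorphXn /= !hev_lowest //.
  have -> : c%:~R = (pZtoQ u).[x] * (pZtoQ F).[x] + (pZtoQ v).[x] * (pZtoQ G).[x] :> rat.
    by rewrite -!hornerM -hornerD -!rmorphM -rmorphD uv /= map_polyC hornerC.
  by rewrite exprD; apply/eqP; ring.
have : (p%:Z %| c * denq x ^+ (N + d))%Z by rewrite -eq rpredD // dvdz_mull.
by case/(prime_dvdzM pp) => // /(prime_dvdzX pp) h; rewrite h in pB.
Qed.

Variables (y : nat -> rat).
Hypotheses (yG : forall m, (pZtoQ G).[y m] != 0).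
Hypotheses (yS : forall m, y m.+1 = (pZtoQ F).[y m] / (pZtoQ G).[y m]).
Hypothesis (y0 : forall m, y m != 0).

Lemma orbit_step m : exists t, hmap d F G (lowest (y m)) = pscale t (lowest (y m.+1)).
Proof.
have B0 : (denq (y m))%:~R ^+ d != 0 :> rat by rewrite expf_neq0 // intr_eq0 denq_neq0.
apply: lowest_fraction; first by rewrite -(intr_eq0 rat) hev_lowest // mulf_neq0.
by rewrite !hev_lowest // yS invfM mulrACA mulfV // mul1r.
Qed.

(** [T] collects the factors cancelled on the way to lowest terms. A prime dividing one of them
    divides both coordinates at some step. *)
Lemma orbit_iter (M : nat) : (forall p x, prime p ->
  (p%:Z %| hev d F (lowest x))%Z -> (p%:Z %| hev d G (lowest x))%Z -> (p %| M)%N) ->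
  forall k m, exists2 T, iter k (hmap d F G) (lowest (y m)) = pscale T (lowest (y (m + k)))
    & forall p, prime p -> (p%:Z %| T)%Z -> (p %| M)%N.
Proof.
move=> hM; elim=> [|k IH] m.
  exists 1; first by rewrite /= addn0 /pscale !mul1r.
  by move=> p pp; rewrite dvdzE /= Euclid_dvd1.
have [T hT Tp] := IH m; have [t ht] := orbit_step (m + k).
exists (T ^+ d * t); first by rewrite iterS hT hmap_scale ht /pscale /= !mulrA addnS.
move=> p pp /(prime_dvdzM pp) [/(prime_dvdzX pp)|pt]; first exact: Tp.
apply: (hM p (y (m + k)) pp); move: ht; rewrite /hmap /pscale => -[h1 h2];
  by rewrite ?h1 ?h2 dvdz_mulr.
Qed.

Lemma orbit_cofactor m : hev d F (lowest (y m)) = numq (y m) ^+ e * hev (d - e) P (lowest (y m)).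
Proof. by rewrite FE hev_MXn ?(size_cofactor ed FE P0 sF) // ltnW. Qed.

Lemma orbit_cofactor_neq0 m : hev (d - e) P (lowest (y m)) != 0.
Proof.
apply/eqP => h; have := orbit_cofactor m; rewrite h mulr0.
have B0 : (denq (y m))%:~R ^+ d != 0 :> rat by rewrite expf_neq0 // intr_eq0 denq_neq0.
move=> h0; have := hev_lowest (y m) sF; rewrite h0 => /esym/eqP.
rewrite mulf_eq0 (negPf B0) /= => /eqP Fy; have := y0 m.+1.
by rewrite yS Fy mul0r eqxx.
Qed.

Lemma orbit_dvd_step (M p m : nat) : (forall p x, prime p ->
  (p%:Z %| hev d F (lowest x))%Z -> (p%:Z %| hev d G (lowest x))%Z -> (p %| M)%N) ->
  prime p -> ~~ (p %| M)%N -> (p%:Z %| hev d F (lowest (y m)))%Z -> (p%:Z %| numq (y m.+1))%Z.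
Proof.
move=> hM pp pM pF; have [t ht] := orbit_step m.
have := pF; have -> : hev d F (lowest (y m)) = t * numq (y m.+1) by case: ht.
case/(prime_dvdzM pp) => // pt; case/negP: pM; apply: (hM p (y m)) => //.
by have -> : hev d G (lowest (y m)) = t * denq (y m.+1); [case: ht|rewrite dvdz_mulr].
Qed.

Lemma orbit_dvd_mono (M p i j : nat) : (forall p x, prime p ->
  (p%:Z %| hev d F (lowest x))%Z -> (p%:Z %| hev d G (lowest x))%Z -> (p %| M)%N) ->
  prime p -> ~~ (p %| M)%N -> (i <= j)%N -> (p%:Z %| numq (y i))%Z -> (p%:Z %| numq (y j))%Z.
Proof.
move=> hM pp pM /subnK <- pi; elim: (j - i)%N => // n IH.
rewrite addSn; apply: (orbit_dvd_step hM pp pM).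
by rewrite orbit_cofactor dvdz_mulr //; case: (e) e0 => // e' _; rewrite exprS dvdz_mulr.
Qed.

End Orbit.

(** * Primitive divisors along an infinite orbit *)

Lemma injective_finite (T : eqType) (y : nat -> T) (L : seq T) : injective y ->
  exists N, forall m, y m \in L -> (m < N)%N.
Proof.
move=> inj; elim: L => [|a L [N hN]]; first by exists 0%N.
have [[i hi]|h] := classic (exists i, y i = a); last first.
  by exists N => m; rewrite inE => /orP [/eqP ym|/hN //]; case: h; exists m.
exists (maxn N i.+1) => m; rewrite inE leq_max => /orP [/eqP ym|/hN ->//].
by rewrite (inj m i) ?ltnSn ?orbT // ym hi.
Qed.

Lemma infinite_orbit_inj (T : eqType) (f : T -> T) (x : T) :
  ~ (exists s : seq T, forall n, iter n f x \in s) -> injective (fun n => iter n f x).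
Proof.
move=> hs.
have aux i j : (i < j)%N -> iter i f x <> iter j f x.
  move=> ij hij; apply: hs; exists [seq iter n f x | n <- iota 0 j] => n.
  elim/ltn_ind: n => n IH; have [nj|jn] := ltnP n j.
    by apply/mapP; exists n; rewrite // mem_iota.
  have -> : iter n f x = iter ((n - j) + i) f x by rewrite iterD hij -iterD subnK.
  by apply: IH; lia.
move=> i j /= hij; case: (ltngtP i j) => // h; first by case: (aux _ _ h).
by case: (aux _ _ h).
Qed.

Lemma clear_denominators (f g : {poly rat}) : exists (c : rat) (F G : {poly int}),
  [/\ c != 0, c *: f = pZtoQ F & c *: g = pZtoQ G].
Proof.
have [F [a a0 ->]] := rat_poly_scale f; have [G [b b0 ->]] := rat_poly_scale g.
have aQ : a%:~R != 0 :> rat by rewrite intr_eq0.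
have bQ : b%:~R != 0 :> rat by rewrite intr_eq0.
exists (a%:~R * b%:~R), (b *: F), (a *: G); rewrite !map_polyZ !scalerA mulf_neq0 //; split => //.
  by rewrite mulrAC mulfV // mul1r.
by rewrite mulfK.
Qed.

(** [M0] lets finitely many primes be excluded, such as those of numerators that precede the stretch
    of orbit described by [y]. *)
Lemma rat_orbit_zsigmondy (d e : nat) (F G P : {poly int}) (y : nat -> rat) (M0 : nat) :
  (1 < d)%N -> (0 < e)%N -> (e < d)%N -> F = P * 'X^e -> P`_0 != 0 ->
  (size F <= d.+1)%N -> (size G <= d.+1)%N -> (F`_d != 0) || (G`_d != 0) ->
  coprimep (pZtoQ F) (pZtoQ G) ->
  (forall m, (pZtoQ G).[y m] != 0) ->
  (forall m, y m.+1 = (pZtoQ F).[y m] / (pZtoQ G).[y m]) ->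
  (forall m, y m != 0) -> injective y -> (0 < M0)%N ->
  exists N, forall n, (N <= n)%N -> exists p, [/\ prime p, (p%:Z %| numq (y n))%Z,
    ~~ (p %| M0)%N & forall i, (i < n)%N -> ~ (p%:Z %| numq (y i))%Z].
Proof.
move=> d2 e0 ed FE P0 sF sG FGd cFG yG yS y0 yinj M00.
have [M1 M10 hM1] := common_primes sF sG FGd cFG.
(* Apart from the requested [M0], the factor [M1] controls cancellation, and P(0) ensures that no
   other prime divides both A and P(A, B). *)
pose M := (M0 * M1 * `|(P`_0)%R|)%N.
have M_gt0 : (0 < M)%N by rewrite /M !muln_gt0 M00 M10 absz_gt0.
have hM p x : prime p -> (p%:Z %| hev d F (lowest x))%Z ->
    (p%:Z %| hev d G (lowest x))%Z -> (p %| M)%N.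
  by move=> pp pF pG; rewrite /M dvdn_mulr // dvdn_mull // (hM1 p x).
have [k [s [ssep s3 sdvd]]] := form_poly_separable_factor d2 e0 ed FE P0 sF sG FGd cFG.
have [L hL] := thue_mahler (size_form_poly d (d - e) F G P k) M_gt0 ssep s3 sdvd.
have [N hN] := injective_finite L yinj.
exists (N + k).+1 => n hn; apply: NNPP => hp.
pose m := (n.-1 - k)%N.
have nE : n = (m + k).+1 by rewrite /m; lia.
have := hN m; rewrite ltnNge (_ : (N <= m)%N); last by rewrite /m; lia.
move=> hm; suff /hm : y m \in L by [].
have [T hT Tp] := orbit_iter sF sG yG yS hM k m.
have fE : form d (d - e) F G P k (lowest (y m)) =
    T ^+ (d - e) * hev (d - e) P (lowest (y (m + k))) by rewrite /form hT hev_scale.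
have H0 := orbit_cofactor_neq0 ed FE P0 sF yS y0.
(* A zero [T] would be divisible by a prime above [M]. *)
have T0 : T != 0.
  apply/eqP => T0; have [q qM qp] := prime_above M.
  have := Tp q qp; rewrite T0 dvdz0 => /(_ isT) /(dvdn_leq M_gt0).
  by rewrite leqNgt qM.
apply: hL; rewrite -form_lowest fE; first by rewrite intr_eq0 mulf_neq0 ?expf_neq0.
move=> p z /eqP; rewrite eqr_int => /eqP <- pp pz; apply: contraT => pM.
have : (p%:Z %| T ^+ (d - e) * hev (d - e) P (lowest (y (m + k))))%Z by rewrite dvdzE.
case/(prime_dvdzM pp) => [/(prime_dvdzX pp) /(Tp p pp) h|pH]; first by rewrite h in pM.
(* Here p is prime to M and divides P(A, B) at index n - 1, so it divides A_n. Had it divided an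
   earlier numerator, it would divide A_(n-1), hence P(0) or B_(n-1). So p would be a primitive
   divisor after all. *)
have mono := orbit_dvd_mono e0 ed FE P0 sF sG yG yS hM pp pM.
have pn : (p%:Z %| numq (y n))%Z.
  rewrite nE; apply: (orbit_dvd_step sF sG yG yS hM pp pM).
  by rewrite (orbit_cofactor ed FE P0 sF) dvdz_mull.
case: hp; exists p; split => //.
  by apply: contra pM => h; rewrite /M !dvdn_mulr.
move=> i; rewrite nE ltnS => ik pi.
have pA := mono _ _ ik pi.
case: (prime_dvdzM pp (hev_mod1 pA pH)) => [pP|/(prime_dvdzX pp) pB].
  by case/negP: pM; rewrite /M dvdn_mull // -[p]/(absz p%:Z) -dvdzE.
exact: prime_lowest pp pA pB.
Qed.

Theorem theorem1 (f g : {poly rat}) (alpha : rat) :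
  coprimep f g ->
  (2 <= rdeg f g)%N ->
  ratfun_eval f g (Some 0) = Some 0 ->
  mup 0 f != rdeg f g ->
  ~ (exists s : seq (option rat),
       forall n, ratfun_iter f g n (Some alpha) \in s) ->
  nat_set_finite (in_zsigmondy (fun n => pnum (ratfun_iter f g n (Some alpha)))).
Proof.
move=> cfg d2 fg0 mf hinf; set d := rdeg f g in d2 mf.
pose x n := ratfun_iter f g n (Some alpha).
have xS n : x n.+1 = ratfun_eval f g (x n) by [].
have xinj : injective x := infinite_orbit_inj hinf.
have xn0 n : x n <> Some 0.
  move=> h; have : x n = x n.+1 by rewrite xS h fg0.
  by move/xinj; lia.
have [g00 f00] : g.[0] != 0 /\ f.[0] = 0.
  move: fg0 => /=; case: eqP => // /eqP g0 [] /eqP; rewrite mulf_eq0 invr_eq0.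
  by rewrite (negPf g0) orbF => /eqP.
have f0 : f != 0.
  apply: contraTneq d2 => f0; move: cfg; rewrite f0 coprime0p -size_poly_eq1 => /eqP g1.
  by rewrite /d /rdeg f0 size_poly0 g1.
have [c [F [G [c0 fF gG]]]] := clear_denominators f g.
have sfF : size f = size F by rewrite -(size_scale f c0) fF size_rat_int_poly.
have sgG : size g = size G by rewrite -(size_scale g c0) gG size_rat_int_poly.
have maxE : maxn (size F) (size G) = d.+1.
  by rewrite -sfF -sgG /d /rdeg prednK // leq_max size_poly_gt0 f0.
have sF : (size F <= d.+1)%N by rewrite -maxE leq_maxl.
have sG : (size G <= d.+1)%N by rewrite -maxE leq_maxr.
have FGd : (F`_d != 0) || (G`_d != 0).
  have top (p : {poly int}) : size p = d.+1 -> p`_d != 0.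
    by move=> sp; rewrite -[d]/(d.+1.-1) -sp -lead_coefE lead_coef_eq0 -size_poly_eq0 sp.
  apply/orP; move: maxE; rewrite /maxn; case: ifP => _ /top; by [right|left].
have F0 : F != 0 by rewrite -size_poly_eq0 -sfF size_poly_eq0.
have hF z : (pZtoQ F).[z] = c * f.[z] by rewrite -fF hornerZ.
have hG z : (pZtoQ G).[z] = c * g.[z] by rewrite -gG hornerZ.
have ex : exists i, F`_i != 0 by exists (size F).-1; rewrite -lead_coefE lead_coef_eq0.
case: (ex_minnP ex) => e Fe emin.
have [P FE] : exists P, F = P * 'X^e.
  exists (drop_poly e F); apply/polyP => i; rewrite coefMXn coef_drop_poly.
  case: ltnP => h; last by rewrite subnK.
  by apply/eqP; apply: contraTT h => /emin; rewrite -leqNgt.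
have P0 : P`_0 != 0 by move: Fe; rewrite FE coefMXn ltnn subnn.
have e0 : (0 < e)%N.
  rewrite lt0n; apply/eqP => e0; move: Fe; rewrite e0 -(intr_eq0 rat) -coef_map /=.
  by rewrite -horner_coef0 hF f00 mulr0 eqxx.
have mupe : mup 0 f = e.
  have fE : f = (c^-1 *: pZtoQ P) * ('X - 0%:P) ^+ e.
    have FQ : pZtoQ F = pZtoQ P * 'X^e by rewrite FE rmorphM /= map_polyXn.
    by rewrite subr0 -scalerAl -FQ -fF scalerA mulVf // scale1r.
  have r0 : ~~ root (c^-1 *: pZtoQ P) 0.
    by rewrite rootZ ?invr_eq0 // rootE horner_coef0 coef_map intr_eq0.
  apply/eqP; rewrite eqn_leq; apply/andP; split.
    rewrite leqNgt mup_geq // fE exprS dvdp_mul2r ?expf_neq0 ?polyXsubC_eq0 //.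
    by rewrite dvdp_XsubCl.
  by rewrite mup_geq // fE dvdp_mull.
have ed : (e < d)%N.
  rewrite ltn_neqAle -mupe mf /= mupe -ltnS; apply: leq_trans sF.
  by rewrite ltnNge; apply: contra Fe => h; rewrite nth_default.
have cFG : coprimep (pZtoQ F) (pZtoQ G).
  by rewrite -fF -gG coprimepZl // coprimepZr.
(* An injective orbit meets infinity at most once; past that index it stays in Q. *)
have [n0 hn0] : exists n0, forall n, (n0 <= n)%N -> x n <> None.
  have [[i hi]|h] := classic (exists i, x i = None); last first.
    by exists 0%N => n _ hn; apply: h; exists n.
  exists i.+1 => n hn hxn; have : n = i by apply: xinj; rewrite hxn.
  by lia.
pose y m := odflt 0 (x (n0 + m)%N).
have xy m : x (n0 + m)%N = Some (y m).
  by rewrite /y; case: (x (n0 + m)%N) (hn0 (n0 + m)%N (leq_addr _ _)).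
have step m : g.[y m] != 0 /\ y m.+1 = f.[y m] / g.[y m].
  have := xy m.+1; rewrite addnS xS xy /=; case: eqP => // /eqP gy [<-] //.
have yinj : injective y.
  by move=> i j h; apply/(@addnI n0)/xinj; rewrite !xy h.
(* A prime not dividing [M0] divides no numerator before index [n0]. The product is not 0, as the
   orbit avoids 0 and the numerator at infinity is 1. *)
pose M0 := (\prod_(i < n0) `|pnum (x i)|)%N.
have M00 : (0 < M0)%N.
  apply: prodn_gt0 => i; rewrite absz_gt0; case xi : (x i) => [q|] //=.
  by rewrite numq_eq0; apply/eqP => q0; apply: (xn0 i); rewrite xi q0.
have [|||N hN] := @rat_orbit_zsigmondy d e F G P y M0 d2 e0 ed FE P0 sF sG FGd cFG _ _ _ yinj M00.
- by move=> m; rewrite hG mulf_neq0 // (step m).1.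
- move=> m; rewrite (step m).2 hF hG invfM mulrACA mulfV // mul1r //.
- by move=> m; apply/eqP => ym; apply: (xn0 (n0 + m)%N); rewrite xy ym.
exists (n0 + N)%N => n nZ; rewrite ltnNge; apply/negP => hn; apply: nZ.
have nE : n = (n0 + (n - n0))%N by lia.
have [|p [pp pn pM hp]] := hN (n - n0)%N; first by lia.
exists p; split => //; split; first by rewrite -/(x n) nE xy.
move=> i hi; rewrite -/(x i); have [h|h] := ltnP i n0.
  move=> pi; case/negP: pM; rewrite /M0 (bigD1 (Ordinal h)) //= dvdn_mulr //.
rewrite -(subnKC h) xy; apply: hp.
by rewrite ltn_sub2r // (leq_ltn_trans h hi).
Qed.
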